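(* Let $M=\mathbf R/2\pi\mathbf Z$ and let $a:M\to\mathscr H_n^+(\mathbf C)$ be of one of the following two types: (1) $a$ is piecewise constant (not necessarily continuous) with finitely many pieces; or (2) $a(x)=\sum_{i=1}^{m}a_i\,\psi\big(x+2\pi(i-1)/m\big)$ for some integer $m\ge1$, some matrices $a_1,\dots,a_m\in\mathscr H_n^+(\mathbf C)$, and some smooth non-negative function $\psi$ on $M$ with $\int_{M}\psi=1$ and $\operatorname{supp}\psi\subset(0,2\pi/m)$. Then the limit $\displaystyle\lim_{\lambda\to\infty}\frac{C_\infty(\lambda a)}{\lambda}$ exists, is non-negative and finite, and the limit $\displaystyle\lim_{\lambda\to0^+}\frac{C_\infty(\lambda a)}{\lambda}$ exists and is finite.
   Context: $n\ge1$ is an integer and $\mathscr H_n^+(\mathbf C)$ is the set of positive-semidefinite Hermitian $n\times n$ complex matrices. The circle $M=\mathbf R/2\pi\mathbf Z$ carries its standard metric. Let $S^*M=\{(x,\xi)\in T^*M:|\xi|_g=1/2\}$ and let $\phi$ be the geodesic flow on $S^*M$ (the Hamiltonian flow generated by $|\xi|_g^2$; it moves at unit speed, in the positive or negative direction of the circle according to the sign of $\xi$). Write $(x_t,\xi_t)=\phi_t(x_0,\xi_0)$. For a damping term $a$ and $(x_0,\xi_0)\in S^*M$ let $G_t^+(x_0,\xi_0)\in\mathscr M_n(\mathbf C)$ be the solution of $G_0^+(x_0,\xi_0)=\mathrm{Id}_n$, $\partial_tG_t^+(x_0,\xi_0)=-a(x_t)G_t^+(x_0,\xi_0)$ (when $a$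 is only piecewise constant, the continuous, piecewise $C^1$ solution, the equation holding away from the jump times). With $\|\cdot\|_2$ the operator norm associated with the Euclidean norm on $\mathbf C^n$, $$C_\infty(a)=\lim_{t\to\infty}\frac{-1}{t}\sup_{(x_0,\xi_0)\in S^*M}\ln\big(\|G_t^+(x_0,\xi_0)\|_2\big)$$ (this limit exists). *)

(* Defs.v *)
From mathcomp Require Import all_boot all_order all_algebra.
From mathcomp Require Import spectral sesquilinear.
From mathcomp Require Import complex.
From mathcomp Require Import all_classical all_reals all_analysis.
From mathcomp Require Import ring.

Set Implicit Arguments.
Unset Strict Implicit.
Unset Printing Implicit Defensive.

Import Order.TTheory GRing.Theory Num.Theory.
Import numFieldNormedType.Exports.

Local Open Scope classical_set_scope.
Local Open Scope ring_scope.
Local Open Scope complex_scope.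

(* The circle R / 2 pi Z is handled through its universal cover: a function on
   the circle is a 2 pi-periodic function on R, and a point of the circle is
   represented by any of its lifts. *)
Definition circle_fun (R : realType) (T : Type) (f : R -> T) : Prop :=
  forall x, f (x + 2 * pi) = f x.

(* The order of R[i] makes 0 <= z mean that z is real and nonnegative. *)
Definition psd_hermitian (R : realType) (n : nat) (A : 'M[R[i]]_n) : Prop :=
  A \is hermsymmx /\
  forall v : 'cV[R[i]]_n, 0 <= ((map_mx Num.conj v^T) *m A *m v) 0 0.

Definition damping (R : realType) (n : nat) (a : R -> 'M[R[i]]_n) : Prop :=
  circle_fun a /\ forall x, psd_hermitian (a x).

(* [itv_partition 0 (2 * pi) s] says that 0 < s_0 < ... < s_k = 2 pi; the values
   at the breakpoints are unconstrained. *)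
Definition piecewise_constant (R : realType) (T : Type) (a : R -> T) : Prop :=
  exists2 s : seq R, itv_partition 0 (2 * pi) s &
    forall k, (k < size s)%N ->
      exists A : T, forall x,
        nth 0 (0 :: s) k < x < nth 0 s k -> a x = A.

Definition smooth (R : realType) (f : R -> R) : Prop :=
  forall k x, derivable (derive1n k f) x 1.

(* supp f is contained in the arc (a, b) of the circle, where 0 <= a <= b <= 2 pi:
   the right-hand side is the preimage of that arc in R, and the closure on
   the left is the preimage of the support of f in the circle. *)
Definition circle_supp_in (R : realType) (f : R -> R) (a b : R) : Prop :=
  closure [set x | f x != 0] `<=`
  [set x | exists k : int, a < x + k%:~R * (2 * pi) < b].

Definition bump (R : realType) (m : nat) (psi : R -> R) : Prop :=
  [/\ circle_fun psi, smooth psi, forall x, 0 <= psi x,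
    (\int[lebesgue_measure]_(x in `[0%R, (2 * pi)%R]) (psi x)%:E = 1)%E &
    circle_supp_in psi 0 (2 * pi / m%:R)].

(* The index i : 'I_m runs from 0, so the shift 2 pi (i - 1) / m of the usual
   1-based indexing reads 2 pi i / m. *)
Definition bump_damping (R : realType) (n : nat) (a : R -> 'M[R[i]]_n) : Prop :=
  exists m : nat, exists A : 'I_m -> 'M[R[i]]_n, exists psi : R -> R,
    [/\ (1 <= m)%N, forall i, psd_hermitian (A i), bump m psi &
      forall x, a x =
        \sum_(i < m) (psi (x + 2 * pi * i%:R / m%:R))%:C *: A i].

(* S^*M in coordinates: covectors (x, xi) over the (unrolled) circle; |xi|_g = |xi|. *)
Definition cosphere (R : realType) : set (R * R) :=
  [set z | `|z.2| = 1 / 2].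

Definition geodesic_flow (R : realType) (t : R) (z : R * R) : R * R :=
  (z.1 + 2 * z.2 * t, z.2).

Definition hamiltonian (R : realType) (z : R * R) : R := `|z.2| ^+ 2.

Lemma geodesic_flow0 (R : realType) (z : R * R) : geodesic_flow 0 z = z.
Proof. by case: z => x xi; rewrite /geodesic_flow /= mulr0 addr0. Qed.

(* Hamilton's equations x' = dp/dxi, xi' = - dp/dx for p = |xi|_g^2. *)
Lemma geodesic_flow_hamilton (R : realType) (z : R * R) (t : R) :
  let phi := fun s => geodesic_flow s z in
  [/\ is_derive t 1 (fun s => (phi s).1)
        (derive1 (fun xi => hamiltonian ((phi t).1, xi)) (phi t).2) &
      is_derive t 1 (fun s => (phi s).2)
        (- derive1 (fun x => hamiltonian (x, (phi t).2)) (phi t).1)].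
Proof.
have dsq (y : R) : is_derive y 1 (fun xi : R => `|xi| ^+ 2) (2 * y).
  have -> : (fun xi : R => `|xi| ^+ 2) = (fun xi : R => xi ^+ 2).
    by apply/funext => xi; rewrite real_normK // num_real.
  by apply: is_derive_eq; rewrite scaler1 /= mulr_natl.
rewrite /geodesic_flow /hamiltonian /=; split.
  rewrite derive1E (@derive_val _ _ _ _ _ _ _ (dsq z.2)).
  by apply: is_derive_eq; rewrite /GRing.scale /= add0r; ring.
rewrite derive1_cst oppr0; exact: is_derive_cst.
Qed.

(* Continuity and derivatives of C-matrix-valued functions of a real variable,
   read on the real and imaginary parts of the entries. *)
Definition mx_continuous_at (R : realType) (m n : nat) (F : R -> 'M[R[i]]_(m, n))
    (t : R) : Prop :=
  forall i j, {for t, continuous (fun s => complex.Re (F s i j))} /\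
              {for t, continuous (fun s => complex.Im (F s i j))}.

Definition mx_is_derive (R : realType) (m n : nat) (F : R -> 'M[R[i]]_(m, n))
    (t : R) (D : 'M[R[i]]_(m, n)) : Prop :=
  forall i j, is_derive t 1 (fun s => complex.Re (F s i j)) (complex.Re (D i j)) /\
              is_derive t 1 (fun s => complex.Im (F s i j)) (complex.Im (D i j)).

(* G_0 = Id and dG_t/dt = - a(x_t) G_t.  The jump times are the discontinuities of
   t |-> a(x_t); there G is only required to be continuous.  For a piecewise
   constant, the equation itself makes such a G piecewise C^1. *)
Definition is_propagator (R : realType) (n : nat) (a : R -> 'M[R[i]]_n)
    (z : R * R) (G : R -> 'M[R[i]]_n) : Prop :=
  let ax := fun t => a (geodesic_flow t z).1 in
  [/\ G 0 = 1%:M,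
      forall t, mx_continuous_at G t &
      forall t, mx_continuous_at ax t -> mx_is_derive G t (- (ax t *m G t))].

(* [xget] picks the solution, which is unique for the dampings considered; the
   default value is only taken when there is no solution. *)
Definition propagator (R : realType) (n : nat) (a : R -> 'M[R[i]]_n)
    (t : R) (z : R * R) : 'M[R[i]]_n :=
  xget (fun=> 1%:M) [set G | is_propagator a z G] t.

Definition enorm (R : realType) (n : nat) (v : 'cV[R[i]]_n) : R :=
  Num.sqrt (\sum_i Normc.normc (v i 0) ^+ 2).

Definition opnorm (R : realType) (n : nat) (A : 'M[R[i]]_n) : R :=
  sup [set enorm (A *m v) | v in [set v : 'cV[R[i]]_n | enorm v <= 1]].

(* z ranges over lifts of points of S^*M, over which the propagator is
   2 pi-periodic in z.1; [lim] is only meaningful when the limit exists. *)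
Definition C_infty (R : realType) (n : nat) (a : R -> 'M[R[i]]_n) : R :=
  lim (((-1) / t * sup [set ln (opnorm (propagator a t z)) | z in @cosphere R])
         @[t --> +oo_R]).

Definition scale_damping (R : realType) (n : nat) (lambda : R)
    (a : R -> 'M[R[i]]_n) : R -> 'M[R[i]]_n :=
  fun x => lambda%:C *: a x.

(* Main.v *)
Require Import Defs.
From mathcomp Require Import all_boot all_order all_algebra.
From mathcomp Require Import spectral sesquilinear.
From mathcomp Require Import complex.
From mathcomp Require Import all_classical all_reals all_analysis.
From mathcomp Require Import ring lra zify.

Set Implicit Arguments.
Unset Strict Implicit.
Unset Printing Implicit Defensive.

Import Order.TTheory GRing.Theory Num.Theory.
Import numFieldNormedType.Exports.
Import Normc.

Local Open Scope classical_set_scope.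
Local Open Scope ring_scope.
Local Open Scope complex_scope.

(** Why the limits exist. The circle is cut into finitely many arcs on each of
    which the damping is a nonnegative scalar function times one fixed matrix
    A_k >= 0. Crossing such an arc with the damping lam a multiplies the solution by
    exp(- lam s_k A_k), s_k being the integral of the scalar function, so one full
    turn amounts to the monodromy
      P(lam) = exp(- lam s_N A_N) ... exp(- lam s_1 A_1),
    and turning backward to its adjoint. The propagator at time t is a power of
    P(lam) with exponent about t / (2 pi), up to factors bounded independently of t
    and of the starting point. By Gelfand's formula
      C_infty(lam a) = - ln rho(P(lam)) / (2 pi)
    where rho is the spectral radius; this is [C_inftyE]. What remains is to study
    ln rho(P(lam)) / lam.

    Since the A_k are hermitian, the entries of P(lam), hence the coefficients of its
    characteristic polynomial, are finite sums of terms c exp(k lam) with k real. At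
    infinity such a sum is either identically 0 or equivalent to one exponential
    ([expsum_asymptotics]). Dividing the eigenvalues by exp(gam lam), where gam is the
    largest slope of the Newton polygon, gives polynomials that converge to a monic
    polynomial with a nonzero root ([char_poly_scaling]); by continuity of roots
    rho(P(lam)) exp(- gam lam) is bounded and bounded away from 0, so
    ln rho(P(lam)) / lam tends to gam ([ln_spectral_radius_cvgy]). As P(lam) is a
    product of contractions, gam <= 0.

    Near 0, the matrix (1 - P(lam)) / lam has a limit, so its eigenvalues mu converge
    to the roots of a fixed polynomial; those of P(lam) are the 1 - lam mu, of modulus
    1 - lam Re mu + O(lam^2), and ln rho(P(lam)) / lam tends to the opposite of the
    least real part of these roots ([ln_spectral_radius_cvg0]).

    The propagator being selected among all solutions, a solution has to be exhibited
    and shown to be unique ([transfer_is_propagator], [propagator_unique]). A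
    breakpoint at which the damping is accidentally continuous also has to satisfy
    the equation; there, and for uniqueness across breakpoints, the tool is
    [mx_derive_of_punctured]. *)

(** * Complex numbers and matrix norms *)

Local Notation adj M := (map_mx Num.conj (M^T)).

Section ComplexModulus.
Variable R : rcfType.
Implicit Types x y : R[i].

Lemma complex_ReM (x y : R[i]) :
  complex.Re (x * y) = complex.Re x * complex.Re y - complex.Im x * complex.Im y.
Proof. by case: x y => a b [c d]. Qed.

Lemma complex_ImM (x y : R[i]) :
  complex.Im (x * y) = complex.Re x * complex.Im y + complex.Im x * complex.Re y.
Proof. by case: x y => a b [c d]. Qed.

Lemma conj_Re (z : R[i]) : complex.Re (Num.conj z) = complex.Re z.
Proof. by case: z. Qed.

Lemma conj_Im (z : R[i]) : complex.Im (Num.conj z) = - complex.Im z.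
Proof. by case: z. Qed.

Lemma complex_ReD (x y : R[i]) : complex.Re (x + y) = complex.Re x + complex.Re y.
Proof. by case: x y => a b [c d]. Qed.

Lemma complex_ImD (x y : R[i]) : complex.Im (x + y) = complex.Im x + complex.Im y.
Proof. by case: x y => a b [c d]. Qed.

Lemma complex_Re_sum I (r : seq I) (f : I -> R[i]) :
  complex.Re (\sum_(i <- r) f i) = \sum_(i <- r) complex.Re (f i).
Proof. by apply: (big_morph (@complex.Re R)) => // x y; exact: complex_ReD. Qed.

Lemma complex_Im_sum I (r : seq I) (f : I -> R[i]) :
  complex.Im (\sum_(i <- r) f i) = \sum_(i <- r) complex.Im (f i).
Proof. by apply: (big_morph (@complex.Im R)) => // x y; exact: complex_ImD. Qed.

Lemma normcD x y : normc (x + y) <= normc x + normc y.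
Proof. exact: le_normcD. Qed.

Lemma normcNE x : normc (- x) = normc x.
Proof. exact: normcN. Qed.

Lemma normc_ge0 x : 0 <= normc x.
Proof. by case: x => a b /=; exact: sqrtr_ge0. Qed.

Lemma normcX x k : normc (x ^+ k) = normc x ^+ k.
Proof. by elim: k => [|k IH]; rewrite ?expr0 ?normc1 // !exprS normcM IH. Qed.

Lemma normc_real (r : R) : normc r%:C = `|r|.
Proof. by rewrite /normc /= expr0n addr0 sqrtr_sqr. Qed.

Lemma normc_sum I (r : seq I) (P : pred I) (F : I -> R[i]) :
  normc (\sum_(i <- r | P i) F i) <= \sum_(i <- r | P i) normc (F i).
Proof.
elim/big_ind2 : _ => [|u x v y hx hy|//]; first by rewrite normc0.
by apply: le_trans (normcD _ _) _; rewrite lerD.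
Qed.

Lemma normc_prod I (r : seq I) (P : pred I) (F : I -> R[i]) :
  normc (\prod_(i <- r | P i) F i) = \prod_(i <- r | P i) normc (F i).
Proof.
by elim/big_ind2 : _ => [|u x v y <- <-|//]; rewrite ?normc1 ?normcM.
Qed.

Lemma normc_eq0 x : (normc x == 0) = (x == 0).
Proof. by apply/eqP/eqP => [/eq0_normc|->]; rewrite ?normc0. Qed.

Lemma normc_gt0 x : (0 < normc x) = (x != 0).
Proof. by rewrite lt_def normc_eq0 normc_ge0 andbT. Qed.

Lemma Re_le_normc x : `|complex.Re x| <= normc x.
Proof.
case: x => a b /=; rewrite -sqrtr_sqr ler_sqrt ?addr_ge0 ?sqr_ge0 // lerDl.
by rewrite sqr_ge0.
Qed.

Lemma normc_le_ReIm x : normc x <= `|complex.Re x| + `|complex.Im x|.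
Proof.
case: x => a b /=; have ab0 : 0 <= `|a| + `|b| by rewrite addr_ge0.
rewrite -[leRHS]ger0_norm// -(sqrtr_sqr (`|a| + `|b|)) ler_sqrt ?sqr_ge0//.
rewrite sqrrD !real_normK ?num_real//.
by rewrite addrAC lerDl mulrn_wge0// mulr_ge0.
Qed.

End ComplexModulus.

Section MatrixNorm.
Variable R : rcfType.

(** Any submultiplicative norm would do: growth rates of powers do not depend on
    the choice, and this one only involves the moduli of the entries. *)
Definition mxnorm1 m n (A : 'M[R[i]]_(m, n)) : R := \sum_i \sum_j normc (A i j).

Lemma mxnorm1_ge0 m n (A : 'M[R[i]]_(m, n)) : 0 <= mxnorm1 A.
Proof. by apply: sumr_ge0 => i _; apply: sumr_ge0 => j _; exact: normc_ge0. Qed.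

Lemma le_mxnorm1 m n (A : 'M[R[i]]_(m, n)) i j : normc (A i j) <= mxnorm1 A.
Proof.
rewrite /mxnorm1 (bigD1 i)//= (bigD1 j)//= -addrA lerDl addr_ge0//.
  by apply: sumr_ge0 => k _; exact: normc_ge0.
by apply: sumr_ge0 => k _; apply: sumr_ge0 => l _; exact: normc_ge0.
Qed.

Lemma mxnorm1D m n (A B : 'M[R[i]]_(m, n)) :
  mxnorm1 (A + B) <= mxnorm1 A + mxnorm1 B.
Proof.
rewrite -big_split /=; apply: ler_sum => i _; rewrite -big_split /=.
by apply: ler_sum => j _; rewrite mxE normcD.
Qed.

Lemma mxnorm1Z m n (c : R[i]) (A : 'M[R[i]]_(m, n)) :
  mxnorm1 (c *: A) = normc c * mxnorm1 A.
Proof.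
rewrite mulr_sumr; apply: eq_bigr => i _; rewrite mulr_sumr.
by apply: eq_bigr => j _; rewrite mxE normcM.
Qed.

Lemma mxnorm1_gt0 m n (A : 'M[R[i]]_(m, n)) : A != 0 -> 0 < mxnorm1 A.
Proof.
apply: contra_neqT; rewrite -leNgt => h.
apply/matrixP => i j; rewrite mxE; apply: eq0_normc; apply/eqP.
by rewrite eq_le normc_ge0 andbT (le_trans (le_mxnorm1 _ _ _)).
Qed.

Lemma mxnorm1M m n p (A : 'M[R[i]]_(m, n)) (B : 'M[R[i]]_(n, p)) :
  mxnorm1 (A *m B) <= mxnorm1 A * mxnorm1 B.
Proof.
apply: (@le_trans _ _
    (\sum_i \sum_k \sum_j normc (A i j) * normc (B j k))).
  apply: ler_sum => i _; apply: ler_sum => k _; rewrite mxE.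
  by apply: le_trans (normc_sum _ _ _) _; apply: ler_sum => j _; rewrite normcM.
rewrite mulr_suml; apply: ler_sum => i _; rewrite exchange_big /= mulr_suml.
apply: ler_sum => j _; rewrite -mulr_sumr ler_wpM2l ?normc_ge0//.
rewrite /mxnorm1 (bigD1 j)//= lerDl.
by apply: sumr_ge0 => k _; apply: sumr_ge0 => l _; exact: normc_ge0.
Qed.

Lemma mxnorm1_adj m n (A : 'M[R[i]]_(m, n)) :
  mxnorm1 (adj A) = mxnorm1 A.
Proof.
rewrite /mxnorm1 exchange_big; apply: eq_bigr => i _; apply: eq_bigr => j _.
by rewrite !mxE; case: (A i j) => a b; rewrite /normc /= sqrrN.
Qed.

End MatrixNorm.

(** * Roots of nearby polynomials and spectral radius *)

Section Roots.
Variable R : rcfType.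
Let C : closedFieldType := R[i].

Lemma monic_prod_roots (p : {poly R[i]}) : p \is monic ->
  exists2 s : seq R[i], p = \prod_(z <- s) ('X - z%:P) & size p = (size s).+1.
Proof.
move=> /monicP p1; have [s ps] := @closed_field_poly_normal C p.
exists s; first by rewrite [LHS]ps p1 scale1r.
by rewrite ps p1 scale1r size_prod_XsubC.
Qed.

(** At a root z of p the value of q is small, and it is the product of the n
    distances from z to the roots of q: one of them is less than e. *)
Lemma root_perturb (p q : {poly R[i]}) n (z : R[i]) (e : R) :
  q \is monic -> size p = n.+1 -> size q = n.+1 -> root p z -> 0 < e ->
  (\sum_(j < n.+1) normc (p`_j - q`_j)) * Num.max 1 (normc z) ^+ n < e ^+ n ->
  exists2 z', root q z' & normc (z - z') < e.
Proof.
move=> q1 sp sq /rootP pz e0 small.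
have [s qs] := monic_prod_roots q1; rewrite sq => -[sz_s].
apply: contrapT => far.
have far' x : x \in s -> e <= normc (z - x).
  move=> xs; rewrite leNgt; apply/negP => xe; apply: far; exists x => //.
  by rewrite qs root_prod_XsubC.
have : e ^+ n <= normc q.[z].
  rewrite qs horner_prod normc_prod sz_s.
  elim: (s) far' => [|x t IH] far'; first by rewrite big_nil.
  rewrite big_cons exprS ler_pM ?exprn_ge0 ?(ltW e0)//.
    by rewrite hornerXsubC far'// mem_head.
  by apply: IH => y yt; rewrite far'// inE yt orbT.
rewrite leNgt => /negP; apply; apply: le_lt_trans small.
have -> : normc q.[z] = normc (p.[z] - q.[z]) by rewrite pz add0r normcNE.
rewrite (@horner_coef_wide _ n.+1 p) ?sp// (@horner_coef_wide _ n.+1 q) ?sq//.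
rewrite -sumrB; under eq_bigr do rewrite -mulrBl.
apply: le_trans (normc_sum _ _ _) _; rewrite mulr_suml.
apply: ler_sum => j _; rewrite normcM ler_wpM2l ?normc_ge0// normcX.
have [/= z1|z1] := leP (normc z) 1.
  by rewrite expr1n exprn_ile1// normc_ge0.
by rewrite ler_weXn2l ?(ltW z1)// -ltnS.
Qed.

(** Cauchy's bound: for |z| > 1 the leading term z^n cannot be balanced by the
    others unless |z| is at most the sum of the moduli of the coefficients. *)
Lemma root_bound (p : {poly R[i]}) n (z : R[i]) :
  p \is monic -> size p = n.+1 -> root p z ->
  normc z <= 1 + \sum_(j < n) normc p`_j.
Proof.
move=> /monicP p1 sp /rootP pz; set S := \sum_(j < n) _.
have S0 : 0 <= S by apply: sumr_ge0 => j _; exact: normc_ge0.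
have [z1|z1] := leP (normc z) 1; first by rewrite (le_trans z1)// lerDl.
have z0 : 0 < normc z by exact: lt_trans z1.
case: n sp @S S0 => [|n] sp S S0.
  have /size_poly1P[c c0 pc] : size p == 1%N by rewrite sp.
  by move: pz; rewrite pc hornerC => /eqP; rewrite (negPf c0).
suff : normc z ^+ n.+1 <= S * normc z ^+ n.
  rewrite exprS ler_pM2r ?exprn_gt0// => zS.
  by rewrite (le_trans zS)// lerDr.
move: pz; rewrite (@horner_coef_wide _ n.+2 p) ?sp// big_ord_recr /=.
have -> : p`_n.+1 = 1 by rewrite -p1 lead_coefE sp.
rewrite mul1r => /eqP; rewrite addrC addr_eq0 => /eqP zE.
rewrite -normcX zE normcNE; apply: le_trans (normc_sum _ _ _) _.
rewrite mulr_suml; apply: ler_sum => j _.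
rewrite normcM normcX ler_wpM2l ?normc_ge0// ler_weXn2l ?(ltW z1)//.
by rewrite -ltnS.
Qed.

End Roots.

Section SpectralRadius.
Variables (R : rcfType) (n : nat).
Implicit Type A : 'M[R[i]]_n.+1.

Definition spectral_radius A : R :=
  \big[Num.max/0]_(z <- sval (closed_field_poly_normal
    (char_poly A : {poly (R[i] : closedFieldType)}))) normc z.

Lemma char_poly_roots A z :
  (z \in sval (closed_field_poly_normal
    (char_poly A : {poly (R[i] : closedFieldType)}))) = root (char_poly A) z.
Proof.
case: closed_field_poly_normal => s /= es.
rewrite [char_poly A in RHS]es (monicP (char_poly_monic _)) scale1r.
by rewrite root_prod_XsubC.
Qed.

Lemma le_spectral_radius A z : root (char_poly A) z -> normc z <= spectral_radius A.
Proof. by rewrite -char_poly_roots => zs; apply: le_bigmax_seq. Qed.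

Lemma spectral_radius_root A :
  exists2 z, root (char_poly A) z & normc z = spectral_radius A.
Proof.
rewrite /spectral_radius.
have := char_poly_roots A; set s := sval _ => sE.
have : size s != 0%N.
  rewrite /s; case: closed_field_poly_normal => t /= es.
  have := size_char_poly A; rewrite es (monicP (char_poly_monic _)) scale1r.
  by rewrite size_prod_XsubC => -[->].
have {sE} : forall z, z \in s -> root (char_poly A) z by move=> z; rewrite sE.
elim: s => // x s IH sub _; rewrite big_cons.
have [s0|s0] := eqVneq (size s) 0%N.
  rewrite (size0nil s0) big_nil; exists x; first by rewrite sub// mem_head.
  by rewrite max_l// normc_ge0.
have [|z rz zE] := IH _ s0; first by move=> z zs; rewrite sub// inE zs orbT.
rewrite -zE; have [xz|zx] := leP (normc x) (normc z); first by exists z.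
by exists x => //; rewrite sub// mem_head.
Qed.

Lemma spectral_radius_ge0 A : 0 <= spectral_radius A.
Proof. by have [z _ <-] := spectral_radius_root A; exact: normc_ge0. Qed.

Lemma spectral_radius_gt0 A : A \is a GRing.unit -> 0 < spectral_radius A.
Proof.
move=> uA; have [z rz <-] := spectral_radius_root A.
rewrite normc_gt0; apply/negP => /eqP z0; move: rz.
rewrite z0 -eigenvalue_root_char => /eigenvalueP[v]; rewrite scale0r => vA.
apply/negP; rewrite negbK; apply/eqP.
by rewrite -[v](mulmxK uA) vA mul0mx.
Qed.

Lemma spectral_radius_eigen A :
  exists2 z, normc z = spectral_radius A &
  exists2 v : 'rV_n.+1, v *m A = z *: v & v != 0.
Proof.
have [z rz <-] := spectral_radius_root A; exists z => //.
by apply/eigenvalueP; rewrite eigenvalue_root_char.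
Qed.

(** An eigenvector of A for an eigenvalue of modulus rho is stretched by rho^k. *)
Lemma spectral_radius_power_lb A k : spectral_radius A ^+ k <= mxnorm1 (A ^+ k).
Proof.
have [z <- [v vA v0]] := spectral_radius_eigen A.
have vAk : v *m (A ^+ k) = z ^+ k *: v.
  elim: k => [|k IH]; first by rewrite !expr0 mulmx1 scale1r.
  by rewrite !exprS mulmxA vA -scalemxAl IH scalerA.
have := mxnorm1M v (A ^+ k); rewrite vAk mxnorm1Z normcX mulrC.
by rewrite ler_pM2l// mxnorm1_gt0.
Qed.

(** Peeling off one factor A - z, the sequence A^k Y satisfies the recurrence
    A^(k+1) Y = z A^k Y + A^k (A - z) Y, whose second term is O(r^k) by induction;
    since |z| < r the whole sequence is O(r^k). *)
Lemma power_bound_of_annihilator A (s : seq R[i]) (Y : 'M[R[i]]_n.+1) (r : R) :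
  (forall z, z \in s -> normc z < r) -> 0 < r ->
  (\prod_(z <- s) (A - z%:M)) * Y = 0 ->
  exists2 c : R, 0 < c & forall k, mxnorm1 (A ^+ k * Y) <= c * r ^+ k.
Proof.
move=> + r0; elim/last_ind: s Y => [|s z IH] Y sr.
  rewrite big_nil mul1r => ->; exists 1 => // k.
  rewrite mulr0 mul1r (le_trans _ (exprn_ge0 _ (ltW r0)))// /mxnorm1.
  by rewrite big1// => i _; rewrite big1// => j _; rewrite mxE normc0.
rewrite -cats1 big_cat big_seq1 /= -mulrA => /IH[|c c0 bnd].
  by move=> x xs; rewrite sr// mem_rcons inE xs orbT.
have zr : normc z < r by rewrite sr// mem_rcons mem_head.
have rz : 0 < r - normc z by rewrite subr_gt0.
(* d is at least c / (r - |z|) so that |z| d + c <= d r *)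
pose d := Num.max (1 + mxnorm1 Y) (c / (r - normc z)).
exists d; first by rewrite lt_max ltr_wpDr ?mxnorm1_ge0.
elim=> [|k IHk].
  by rewrite !expr0 mul1r mulr1 /d le_max lerDr ler01.
have -> : A ^+ k.+1 * Y = z *: (A ^+ k * Y) + A ^+ k * ((A - z%:M) * Y).
  rewrite mulrBl mulrBr [z%:M * Y]mul_scalar_mx.
  rewrite -[A ^+ k * (z *: Y)]scalerAr addrC subrK exprSr mulrA.
  by [].
apply: le_trans (mxnorm1D _ _) _; rewrite mxnorm1Z.
apply: (@le_trans _ _ (normc z * (d * r ^+ k) + c * r ^+ k)).
  by rewrite lerD ?bnd// ler_wpM2l// normc_ge0.
rewrite mulrA -mulrDl exprS mulrA ler_wpM2r ?exprn_ge0 ?(ltW r0)//.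
rewrite -lerBrDl -[d * r]mulrC -mulrBl.
by rewrite -ler_pdivrMl// mulrC /d le_max lexx orbT.
Qed.

(** The upper half of Gelfand's formula: by Cayley-Hamilton the linear factors of
    the characteristic polynomial annihilate the identity. *)
Lemma spectral_radius_power_ub A (r : R) : spectral_radius A < r ->
  exists2 c : R, 0 < c & forall k, mxnorm1 (A ^+ k) <= c * r ^+ k.
Proof.
move=> rho_r.
have [s sE _] := monic_prod_roots (char_poly_monic A).
have [] := @power_bound_of_annihilator A s 1 r.
- move=> z zs; apply: le_lt_trans rho_r; apply: le_spectral_radius.
  by rewrite sE root_prod_XsubC.
- exact: le_lt_trans (spectral_radius_ge0 A) rho_r.
- rewrite mulr1 -(Cayley_Hamilton A) sE rmorph_prod /=; apply: eq_bigr => z _.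
  by rewrite rmorphB /= horner_mx_X horner_mx_C.
by move=> c c0 bnd; exists c => // k; have := bnd k; rewrite mulr1.
Qed.

End SpectralRadius.

(** * Limits of complex functions and continuity of roots *)

Section ComplexLimits.
Variables (R : realType) (T : Type) (F : set_system T).
Context {FF : Filter F}.
Implicit Types f g : T -> R[i].

(** Convergence is read on real and imaginary parts, which is also how continuity
    of matrix-valued functions is stated: entrywise, continuity at t is
    [ccvg (nbhs t)]. *)
Definition ccvg f (c : R[i]) : Prop :=
  complex.Re (f t) @[t --> F] --> complex.Re c /\
  complex.Im (f t) @[t --> F] --> complex.Im c.

Lemma ccvg_cst c : ccvg (fun=> c) c.
Proof. by split; exact: cvg_cst. Qed.

Lemma ccvgD f g c d : ccvg f c -> ccvg g d -> ccvg (fun t => f t + g t) (c + d).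
Proof.
move=> [fc1 fc2] [gd1 gd2]; split; rewrite raddfD /=.
  by under eq_fun do rewrite raddfD /=; exact: cvgD.
by under eq_fun do rewrite raddfD /=; exact: cvgD.
Qed.

Lemma ccvgM f g c d : ccvg f c -> ccvg g d -> ccvg (fun t => f t * g t) (c * d).
Proof.
move=> [fc1 fc2] [gd1 gd2]; split.
  rewrite complex_ReM; under eq_fun do rewrite complex_ReM.
  by apply: cvgB; apply: cvgM.
rewrite complex_ImM; under eq_fun do rewrite complex_ImM.
by apply: cvgD; apply: cvgM.
Qed.

Lemma ccvg_real (f : T -> R) (c : R) : f t @[t --> F] --> c -> ccvg (fun t => (f t)%:C) c%:C.
Proof. by move=> fc; split => //=; exact: cvg_cst. Qed.

Lemma ccvg_sum (I : eqType) (r : seq I) (f : I -> T -> R[i]) (c : I -> R[i]) :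
  (forall i, i \in r -> ccvg (f i) (c i)) ->
  ccvg (fun t => \sum_(i <- r) f i t) (\sum_(i <- r) c i).
Proof.
elim: r => [|i r IH] fc.
  by rewrite big_nil; under eq_fun do rewrite big_nil; exact: ccvg_cst.
rewrite big_cons; under eq_fun do rewrite big_cons.
by apply: ccvgD; [apply: fc|apply: IH => j jr; apply: fc];
  rewrite ?mem_head// inE jr orbT.
Qed.

Lemma cvg_sumr I (r : seq I) (f : I -> T -> R) (c : I -> R) :
  (forall i, f i t @[t --> F] --> c i) ->
  \sum_(i <- r) f i t @[t --> F] --> \sum_(i <- r) c i.
Proof.
move=> fc; elim: r => [|i r IH].
  by rewrite big_nil; under eq_fun do rewrite big_nil; exact: cvg_cst.
by rewrite big_cons; under eq_fun do rewrite big_cons; exact: cvgD.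
Qed.

Lemma ccvg_near f g c : (\forall t \near F, f t = g t) -> ccvg f c -> ccvg g c.
Proof.
move=> fg [f1 f2]; split.
  by apply: cvg_trans f1; apply: near_eq_cvg; apply: filterS fg => t ->.
by apply: cvg_trans f2; apply: near_eq_cvg; apply: filterS fg => t ->.
Qed.

Lemma ccvg_normcB f c : ccvg f c -> normc (f t - c) @[t --> F] --> 0.
Proof.
move=> [f1 f2].
have f1' : `|complex.Re (f t) - complex.Re c| @[t --> F] --> 0.
  rewrite -[X in _ --> X](@normr0 _ R) -(subrr (complex.Re c)).
  by apply: cvg_norm; apply: cvgB => //; exact: cvg_cst.
have f2' : `|complex.Im (f t) - complex.Im c| @[t --> F] --> 0.
  rewrite -[X in _ --> X](@normr0 _ R) -(subrr (complex.Im c)).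
  by apply: cvg_norm; apply: cvgB => //; exact: cvg_cst.
have fc : `|complex.Re (f t) - complex.Re c| +
    `|complex.Im (f t) - complex.Im c| @[t --> F] --> 0.
  by rewrite -[X in _ --> X]addr0; exact: cvgD.
apply: (squeeze_cvgr _ (cvg_cst 0) fc).
near=> t; rewrite normc_ge0 /= (le_trans (normc_le_ReIm _))//.
by rewrite !raddfB.
Unshelve. all: by end_near. Qed.

End ComplexLimits.

Section CharPolyCoef.
Variables (A : comNzRingType) (T : Type) (S : (T -> A) -> Prop).
Hypothesis Scst : forall c, S (fun=> c).
Hypothesis SD : forall f g, S f -> S g -> S (fun t => f t + g t).
Hypothesis SM : forall f g, S f -> S g -> S (fun t => f t * g t).

Let S_sum I (r : seq I) (f : I -> T -> A) :
  (forall i, S (f i)) -> S (fun t => \sum_(i <- r) f i t).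
Proof.
move=> Sf; elim: r => [|i r IH]; first by under eq_fun do rewrite big_nil.
by under eq_fun do rewrite big_cons; exact: SD.
Qed.

Let SP (q : T -> {poly A}) := forall k, S (fun t => (q t)`_k).

Let SPD p q : SP p -> SP q -> SP (fun t => p t + q t).
Proof. by move=> Sp Sq k; under eq_fun do rewrite coefD; exact: SD. Qed.

Let SPM p q : SP p -> SP q -> SP (fun t => p t * q t).
Proof.
move=> Sp Sq k; under eq_fun do rewrite coefM.
by apply: S_sum => i; exact: SM.
Qed.

Let SPcst (p : {poly A}) : SP (fun=> p).
Proof. by move=> k; exact: Scst. Qed.

(** The coefficients of the characteristic polynomial are polynomial functions of
    the entries of the matrix. The class S is instantiated below by the functions
    that have a limit along a filter and by the exponential sums. *)
Lemma char_poly_coef_closed n (M : T -> 'M[A]_n) k :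
  (forall i j, S (fun t => M t i j)) -> S (fun t => (char_poly (M t))`_k).
Proof.
move=> SMt; move: k; rewrite -/(SP _).
rewrite /char_poly /determinant.
elim: (index_enum _) => [|s r IH].
  by under eq_fun do rewrite big_nil; exact: SPcst.
under eq_fun do rewrite big_cons; apply: SPD => //.
apply: SPM; first exact: SPcst.
elim: (index_enum _) => [|i r' IH'].
  by under eq_fun do rewrite big_nil; exact: SPcst.
under eq_fun do rewrite big_cons; apply: SPM => //.
move=> k; under eq_fun do rewrite !mxE coefB coefC.
under eq_fun do rewrite -mulN1r; apply: SD; first exact: Scst.
apply: SM; first exact: Scst.
by case: (k == 0)%N.
Qed.

End CharPolyCoef.

Section RootsContinuity.
Variables (R : realType) (T : Type) (F : set_system T).
Context {FF : Filter F}.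

Lemma limit_poly (q : T -> {poly R[i]}) n :
  (forall t, size (q t) = n.+1) -> (forall t, q t \is monic) ->
  (forall k, exists c, ccvg F (fun t => (q t)`_k) c) ->
  exists p : {poly R[i]}, [/\ p \is monic, size p = n.+1 &
    forall k, ccvg F (fun t => (q t)`_k) p`_k].
Proof.
move=> sq mq /choice[c cP].
pose p := 'X^n + \poly_(k < n) c k.
have sp : (size (\poly_(k < n) c k) < size ('X^n : {poly R[i]}))%N.
  by rewrite size_polyXn ltnS size_poly.
exists p; split.
- by rewrite monicE lead_coefDl// lead_coefXn.
- by rewrite size_polyDl// size_polyXn.
- move=> k; rewrite coefD coefXn coef_poly; case: ltngtP => [kn|nk|->].
  + by rewrite add0r.
  + rewrite add0r; under eq_fun do rewrite nth_default ?sq//.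
    exact: ccvg_cst.
  + rewrite addr0; have -> : (fun t => (q t)`_n) = fun=> 1.
      by apply/funext => t; have /monicP := mq t; rewrite lead_coefE sq.
    exact: ccvg_cst.
Qed.

(** The roots of q t stay bounded by B along F, so the sum D t of the distances
    between coefficients, which tends to 0, controls q t - p at all roots of either
    polynomial; [root_perturb] then applies in both directions. *)
Lemma continuity_of_roots (q : T -> {poly R[i]}) (p : {poly R[i]}) n (e : R) :
  (forall t, size (q t) = n.+1) -> (forall t, q t \is monic) ->
  size p = n.+1 -> p \is monic ->
  (forall k, ccvg F (fun t => (q t)`_k) p`_k) -> 0 < e ->
  \forall t \near F,
    (forall z, root (q t) z -> exists2 w, root p w & normc (z - w) < e) /\
    (forall w, root p w -> exists2 z, root (q t) z & normc (w - z) < e).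
Proof.
move=> sq mq sp mp qp e0.
pose D t := \sum_(j < n.+1) normc ((q t)`_j - p`_j).
have D0 t : 0 <= D t by apply: sumr_ge0 => j _; exact: normc_ge0.
have Dcvg : D t @[t --> F] --> 0.
  have : D t @[t --> F] --> \sum_(j < n.+1) (0 : R).
    by apply: cvg_sumr => j; exact: ccvg_normcB.
  by rewrite big1_eq.
pose S := \sum_(j < n) normc p`_j.
have S0 : 0 <= S by apply: sumr_ge0 => j _; exact: normc_ge0.
pose B := 2 + S.
have B1 : 1 <= B by rewrite /B; lra.
have Bn0 : 0 < B ^+ n by rewrite exprn_gt0//; lra.
have near1 : \forall t \near F, D t < 1.
  by have /cvgr0Pnorm_lt/(_ 1 ltr01) := (Dcvg); apply: filterS => t; rewrite ger0_norm.
have near2 : \forall t \near F, D t < e ^+ n / B ^+ n.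
  have he : 0 < e ^+ n / B ^+ n by rewrite divr_gt0// exprn_gt0.
  by have /cvgr0Pnorm_lt/(_ _ he) := (Dcvg); apply: filterS => t; rewrite ger0_norm.
near=> t.
have Dt1 : D t < 1 by near: t.
have Dt2 : D t * B ^+ n < e ^+ n by rewrite -ltr_pdivlMr//; near: t.
have small z : normc z <= B -> D t * Num.max 1 (normc z) ^+ n < e ^+ n.
  move=> zB; apply: le_lt_trans Dt2; rewrite ler_wpM2l// lerXn2r ?nnegrE//.
  - by rewrite le_max ler01.
  - lra.
  - by rewrite ge_max B1.
split => z rz.
- apply: (root_perturb mp (sq t) sp rz e0).
  apply: small; apply: le_trans (root_bound (mq t) (sq t) rz) _.
  have : \sum_(j < n) normc (q t)`_j <= D t + S.
    rewrite /D big_ord_recr /= -addrA addrCA; apply: ler_wpDl; first exact: normc_ge0.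
    rewrite -big_split /=; apply: ler_sum => j _.
    by rewrite -{1}[(q t)`_j](subrK p`_j) normcD.
  rewrite /B; lra.
- apply: (root_perturb (mq t) sp (sq t) rz e0).
  have -> : \sum_(j < n.+1) normc (p`_j - (q t)`_j) = D t.
    by apply: eq_bigr => j _; rewrite -normcNE opprB.
  apply: small; apply: le_trans (root_bound mp sp rz) _.
  by rewrite /B -/S; lra.
Unshelve. all: by end_near. Qed.

End RootsContinuity.

(** * Exponential sums *)

Section ExponentialSums.
Variable R : realType.
Implicit Types f g : R -> R[i].

(** A pair (c, k) stands for the term c exp(k x), with a complex coefficient but a
    real exponent. *)
Definition expsum (s : seq (R[i] * R)) (x : R) : R[i] :=
  \sum_(p <- s) p.1 * (expR (p.2 * x))%:C.

Definition is_expsum f : Prop := exists s, f = expsum s.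

Lemma is_expsum_exp k : is_expsum (fun x => (expR (k * x))%:C).
Proof.
by exists [:: (1, k)]; apply/funext => x; rewrite /expsum big_seq1 mul1r.
Qed.

Lemma is_expsum_cst c : is_expsum (fun=> c).
Proof.
exists [:: (c, 0)]; apply/funext => x.
by rewrite /expsum big_seq1 mul0r expR0 mulr1.
Qed.

Lemma is_expsumD f g : is_expsum f -> is_expsum g -> is_expsum (fun x => f x + g x).
Proof.
move=> [s ->] [t ->]; exists (s ++ t); apply/funext => x.
by rewrite /expsum big_cat.
Qed.

Lemma is_expsumM f g : is_expsum f -> is_expsum g -> is_expsum (fun x => f x * g x).
Proof.
move=> [s ->] [t ->].
exists [seq (p.1 * q.1, p.2 + q.2) | p <- s, q <- t]; apply/funext => x.
rewrite /expsum big_allpairs_dep mulr_suml; apply: eq_bigr => p _.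
rewrite mulr_sumr; apply: eq_bigr => q _ /=.
by rewrite mulrDl expRD rmorphM /= mulrACA.
Qed.

Lemma is_expsum_sum I (r : seq I) (f : I -> R -> R[i]) :
  (forall i, is_expsum (f i)) -> is_expsum (fun x => \sum_(i <- r) f i x).
Proof.
move=> fE; elim: r => [|i r IH].
  by under eq_fun do rewrite big_nil; exact: is_expsum_cst.
by under eq_fun do rewrite big_cons; exact: is_expsumD.
Qed.

Lemma cvgy_expR_lt0 (k : R) : k < 0 -> expR (k * x) @[x --> +oo] --> 0.
Proof.
move=> k0.
have h : - k * x @[x --> +oo] --> +oo.
  by apply: gt0_cvgMry; [rewrite oppr_gt0|exact: cvg_id].
have := cvg_comp _ _ h (@cvgr_expR R).
by apply: cvg_trans; apply: near_eq_cvg; near=> x; rewrite /= mulNr opprK.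
Unshelve. all: by end_near. Qed.

Lemma seq_max (I : eqType) (s : seq I) (f : I -> R) : s != [::] ->
  exists2 x, x \in s & forall y, y \in s -> f y <= f x.
Proof.
elim: s => // x s IH _; have [->|s0] := eqVneq s [::].
  by exists x => [|y]; rewrite inE // => /eqP ->.
have [z zs zP] := IH s0; have [xz|zx] := leP (f x) (f z).
  exists z; first by rewrite inE zs orbT.
  by move=> y; rewrite inE => /predU1P[->//|/zP].
exists x; first by rewrite mem_head.
by move=> y; rewrite inE => /predU1P[->//|/zP yz]; rewrite (le_trans yz)// ltW.
Qed.

(** The terms with the largest exponent k dominate, unless their coefficients add
    up to 0; in that case they can be dropped and the sum gets shorter. *)
Lemma expsum_asymptotics f : is_expsum f ->
  (forall x, f x = 0) \/
  exists k c, c != 0 /\ ccvg +oo_R (fun x => f x * (expR (- k * x))%:C) c.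
Proof.
move=> [s ->]; have [m] := ubnP (size s); elim: m s => // m IH s sm.
have [->|s0] := eqVneq s [::]; first by left => x; rewrite /expsum big_nil.
have [p ps pmax] := seq_max snd s0; pose k := p.2.
pose c : R[i] := \sum_(q <- s | q.2 == k) q.1.
have split x : expsum s x =
    c * (expR (k * x))%:C + expsum [seq q <- s | q.2 != k] x.
  rewrite /expsum (bigID (fun q => q.2 == k)) /= [in RHS]big_filter; congr (_ + _).
  by rewrite mulr_suml; apply: eq_bigr => q /eqP ->.
have [c0|c0] := eqVneq c 0.
  have -> : expsum s = expsum [seq q <- s | q.2 != k].
    by apply/funext => x; rewrite split c0 mul0r add0r.
  apply: IH; apply: leq_trans (_ : size s <= m)%N; last by rewrite -ltnS.
  rewrite size_filter -(count_predC (fun q : R[i] * R => q.2 != k) s).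
  rewrite -{1}[count _ _]addn0 ltn_add2l -has_count; apply/hasP; exists p => //=.
  by rewrite eqxx.
right; exists k, c; split => //.
have -> : (fun x => expsum s x * (expR (- k * x))%:C) =
    fun x => c + \sum_(q <- s | q.2 != k) q.1 * (expR ((q.2 - k) * x))%:C.
  apply/funext => x; rewrite split mulrDl; congr (_ + _).
    by rewrite -mulrA -rmorphM -expRD -mulrDl subrr mul0r expR0 mulr1.
  rewrite /expsum big_filter mulr_suml; apply: eq_bigr => q _.
  by rewrite -mulrA -rmorphM -expRD -mulrDl.
rewrite -[X in ccvg _ _ X]addr0; apply: ccvgD; first exact: ccvg_cst.
under eq_fun do rewrite -big_filter.
rewrite [X in ccvg _ _ X](_ : 0 = \sum_(q <- [seq q <- s | q.2 != k]) 0);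
  last by rewrite big1_eq.
apply: ccvg_sum => q; rewrite mem_filter => /andP[qk qs].
rewrite -(mulr0 q.1); apply: ccvgM; first exact: ccvg_cst.
apply: ccvg_real; apply: cvgy_expR_lt0; rewrite subr_lt0.
by rewrite lt_neqAle qk pmax.
Qed.

Lemma expsum_slope f : is_expsum f ->
  exists c, ccvg (0 : R)^'+ (fun x => (f x - f 0) * (x^-1)%:C) c.
Proof.
move=> [s ->]; exists (\sum_(p <- s) p.1 * p.2%:C).
have -> : (fun x => (expsum s x - expsum s 0) * (x^-1)%:C) =
   (fun x => \sum_(p <- s) p.1 * ((expR (p.2 * x) - 1) * x^-1)%:C).
  apply/funext => x; rewrite /expsum -sumrB mulr_suml; apply: eq_bigr => p _.
  by rewrite mulr0 expR0 -mulrBr -rmorphB /= rmorphM mulrA.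
apply: ccvg_sum => p _; apply: ccvgM; first exact: ccvg_cst.
apply: ccvg_real.
have de : is_derive (0 : R) 1 (fun x => expR (p.2 * x)) p.2.
  apply: is_derive_eq.
  by rewrite /GRing.scale /= ?mulr0 ?expR0 ?scaler0 ?addr0 ?add0r ?mulr1 ?mul1r.
have /cvg_dnbhs_at_right : h^-1 *: (expR (p.2 * (h *: 1 + 0)) - expR (p.2 * 0))
    @[h --> (0 : R)^'] --> p.2.
  rewrite -[X in _ --> X](@derive_val _ _ _ _ _ _ _ de).
  exact: (@ex_derive _ _ _ _ _ _ _ de).
apply: cvg_trans; apply: near_eq_cvg; near=> h.
by rewrite mulr0 expR0 addr0 /GRing.scale /= mulr1 mulrC.
Unshelve. all: by end_near. Qed.

End ExponentialSums.

Lemma char_poly_coef_cvg (R : realType) (T : Type) (F : set_system T)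
    (FF : Filter F) n (Q : T -> 'M[R[i]]_n) k :
  (forall i j, exists c, ccvg F (fun t => Q t i j) c) ->
  exists c, ccvg F (fun t => (char_poly (Q t))`_k) c.
Proof.
apply: (@char_poly_coef_closed _ _ (fun f => exists c, ccvg F f c)).
- by move=> c; exists c; exact: ccvg_cst.
- by move=> f g [c fc] [d gd]; exists (c + d); exact: ccvgD.
- by move=> f g [c fc] [d gd]; exists (c * d); exact: ccvgM.
Qed.

(** * Spectral radius of a matrix of exponential sums *)

Section SpectralRadiusAsymptotics.
Variables (R : realType) (n : nat) (P : R -> 'M[R[i]]_n.+1).
Hypothesis P_expsum : forall i j, is_expsum (fun x => P x i j).
Hypothesis P_unit : forall x, P x \is a GRing.unit.

Lemma char_poly_expsum k : is_expsum (fun x => (char_poly (P x))`_k).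
Proof.
apply: char_poly_coef_closed => //; first exact: is_expsum_cst.
- by move=> f g; exact: is_expsumD.
- by move=> f g; exact: is_expsumM.
Qed.

Lemma cvgy_div (c : R) : c / x @[x --> +oo] --> 0.
Proof.
rewrite -(mulr0 c); apply: cvgM; first exact: cvg_cst.
apply/gtr0_cvgV0; last exact: cvg_id.
exact: nbhs_pinfty_gt.
Qed.

(** The monic polynomial whose roots are the eigenvalues of P x divided by
    exp(gam x). *)
Definition scaled_char_poly gam x : {poly R[i]} :=
  \poly_(j < n.+2) ((char_poly (P x))`_j * (expR (- ((n.+1 - j)%:R * gam * x)))%:C).

Lemma scaled_char_poly_lead gam x : (scaled_char_poly gam x)`_n.+1 = 1.
Proof.
rewrite coef_poly ltnSn subnn !mul0r oppr0 expR0 mulr1.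
by have /monicP := char_poly_monic (P x); rewrite lead_coefE size_char_poly.
Qed.

Lemma size_scaled_char_poly gam x : size (scaled_char_poly gam x) = n.+2.
Proof.
apply/eqP; rewrite eqn_leq size_poly /= ltnNge; apply/negP => h.
have := scaled_char_poly_lead gam x; rewrite nth_default// => /esym/eqP.
by rewrite oner_eq0.
Qed.

Lemma monic_scaled_char_poly gam x : scaled_char_poly gam x \is monic.
Proof. by rewrite monicE lead_coefE size_scaled_char_poly scaled_char_poly_lead. Qed.

Lemma horner_scaled_char_poly gam x z :
  (scaled_char_poly gam x).[(expR (- (gam * x)))%:C * z] =
  (expR (- (n.+1%:R * gam * x)))%:C * (char_poly (P x)).[z].
Proof.
rewrite horner_poly (@horner_coef_wide _ n.+2 (char_poly (P x))) ?size_char_poly//.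
rewrite mulr_sumr; apply: eq_bigr => j _; rewrite exprMn -rmorphXn /=.
have <- : expR (- ((n.+1 - j)%:R * gam * x)) * expR (- (gam * x)) ^+ j =
    expR (- (n.+1%:R * gam * x)).
  rewrite -expRM_natl -expRD natrB; last by rewrite -ltnS.
  by congr expR; ring.
by rewrite rmorphM /=; ring.
Qed.

(** If the j-th coefficient of the characteristic polynomial grows like
    exp(al_j x), let gam be the largest of the al_j / (n + 1 - j), that is, the
    largest slope of the Newton polygon. All scaled coefficients then converge, and
    the one of index j0 realizing the maximum has a nonzero limit, so that the limit
    polynomial is not a power of the variable. The maximum exists because the
    constant coefficient, a determinant up to sign, does not vanish. *)
Lemma char_poly_scaling : exists gam, exists2 p : {poly R[i]},
  [/\ p \is monic, size p = n.+2 & exists2 w, root p w & w != 0] &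
  forall k, ccvg +oo_R (fun x => (scaled_char_poly gam x)`_k) p`_k.
Proof.
pose chi x := char_poly (P x).
have /choice[al /choice[c cP]] : forall j, exists al c,
    (c = 0 /\ forall x, (chi x)`_j = 0) \/
    (c != 0 /\ ccvg +oo_R (fun x => (chi x)`_j * (expR (- al * x))%:C) c).
  move=> j; case: (expsum_asymptotics (char_poly_expsum j)) => [z|[k [c [c0 h]]]].
    by exists 0, 0; left.
  by exists k, c; right.
have c00 : c 0%N != 0.
  case: (cP 0%N) => [[_ /(_ 0)]|[]//].
  rewrite /chi char_poly_det => /eqP; rewrite mulf_eq0 signr_eq0 /=.
  by have := P_unit 0; rewrite unitmxE unitfE => /negPf ->.
pose be (j : 'I_n.+1) := al j / (n.+1 - j)%:R.
have nj0 (j : 'I_n.+1) : (0 : R) < (n.+1 - j)%:R by rewrite ltr0n subn_gt0.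
case: (@arg_maxP _ _ _ ord0 (fun j : 'I_n.+1 => c j != 0) be c00) => j0 cj0 be_max.
pose gam := be j0; exists gam.
pose q x := scaled_char_poly gam x.
have sq x : size (q x) = n.+2 by exact: size_scaled_char_poly.
have mq x : q x \is monic by exact: monic_scaled_char_poly.
pose d (j : nat) : R[i] :=
  if (j < n.+1)%N && (al j == (n.+1 - j)%:R * gam) then c j else (j == n.+1)%:R.
have qd k : ccvg +oo_R (fun x => (q x)`_k) (d k).
  rewrite /d; have [kn|] := ltnP k n.+1; last first.
    rewrite leq_eqVlt => /predU1P[<-|nk].
      by under eq_fun do rewrite scaled_char_poly_lead; rewrite eqxx; exact: ccvg_cst.
    under eq_fun do rewrite coef_poly ltnNge nk /=.
    by rewrite gtn_eqF//; exact: ccvg_cst.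
  under eq_fun do rewrite coef_poly ltnS (ltnW kn).
  case: (cP k) => [[ck0 chi0]|[ck0 lim_k]].
    under eq_fun do rewrite chi0 mul0r.
    by rewrite ck0 ltn_eqF// if_same; exact: ccvg_cst.
  have split_exp x : (chi x)`_k * (expR (- ((n.+1 - k)%:R * gam * x)))%:C =
      (chi x)`_k * (expR (- al k * x))%:C *
      (expR ((al k - (n.+1 - k)%:R * gam) * x))%:C.
    by rewrite -(mulrA (chi x)`_k) -rmorphM -expRD; congr (_ * (expR _)%:C); ring.
  under eq_fun do rewrite split_exp.
  have : al k <= (n.+1 - k)%:R * gam.
    by rewrite mulrC -ler_pdivrMr ?(nj0 (Ordinal kn))//; exact: (be_max (Ordinal kn)).
  rewrite le_eqVlt => /predU1P[ak|ak].
    under [X in ccvg _ X]eq_fun do rewrite ak subrr mul0r expR0 mulr1.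
    by rewrite -ak eqxx.
  rewrite lt_eqF//= ltn_eqF//= -[X in ccvg _ _ X](mulr0 (c k)); apply: ccvgM => //.
  by apply: ccvg_real; apply: cvgy_expR_lt0; rewrite subr_lt0.
have [p [mp sp qp]] := limit_poly sq mq (fun k => ex_intro _ (d k) (qd k)).
exists p; last exact: qp; split => //.
have pd k : p`_k = d k.
  have [a1 a2] := qp k; have [b1 b2] := qd k.
  apply/eqP; rewrite eq_complex; apply/andP; split; apply/eqP.
    exact: (cvg_unique _ a1 b1).
  exact: (cvg_unique _ a2 b2).
have pj0 : p`_j0 != 0.
  rewrite pd /d ltn_ord /= /gam /be mulrCA divff ?mulr1 ?eqxx//.
  by rewrite gt_eqF// nj0.
have [s ps _] := monic_prod_roots mp.
apply: contrapT => no_root; move: pj0; rewrite ps.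
suff -> : \prod_(z <- s) ('X - z%:P) = 'X^(n.+1).
  by rewrite coefXn ltn_eqF// eqxx.
have s0 z : z \in s -> z = 0.
  move=> zs; apply/eqP; apply/negPn/negP => z0; apply: no_root.
  by exists z => //; rewrite ps root_prod_XsubC.
have <- : size s = n.+1.
  by have := sp; rewrite ps size_prod_XsubC => -[].
elim: (s) s0 => [|z t IH] s0; first by rewrite big_nil expr0.
rewrite big_cons IH => [|y yt]; last by apply: s0; rewrite inE yt orbT.
by have -> : z = 0; [exact: s0 (mem_head _ _)|rewrite subr0 exprS].
Qed.

(** Once divided by exp(gam x), the spectral radius stays between two positive
    constants: the scaled eigenvalues approach the roots of the limit polynomial,
    one of which is not 0. *)
Lemma ln_spectral_radius_cvgy :
  exists l : R, ln (spectral_radius (P x)) / x @[x --> +oo] --> l.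
Proof.
have [gam [p [mp sp [w rw w0]] qp]] := char_poly_scaling; exists gam.
pose chi x := char_poly (P x).
pose q x := scaled_char_poly gam x.
have sq x : size (q x) = n.+2 by exact: size_scaled_char_poly.
have mq x : q x \is monic by exact: monic_scaled_char_poly.
pose u := normc w / 2.
have u0 : 0 < u by rewrite divr_gt0// normc_gt0.
pose B := 2 + \sum_(j < n.+1) normc p`_j.
have B0 : 0 < B.
  have : 0 <= \sum_(j < n.+1) normc p`_j by apply: sumr_ge0 => j _; exact: normc_ge0.
  rewrite /B; lra.
have near1 := continuity_of_roots sq mq sp mp qp ltr01.
have near2 := continuity_of_roots sq mq sp mp qp u0.
have lo : gam + ln u / x @[x --> +oo] --> gam.
  rewrite -[X in _ --> X]addr0; apply: cvgD; first exact: cvg_cst.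
  exact: cvgy_div.
have hi : gam + ln B / x @[x --> +oo] --> gam.
  rewrite -[X in _ --> X]addr0; apply: cvgD; first exact: cvg_cst.
  exact: cvgy_div.
apply: (squeeze_cvgr _ lo hi); near=> x.
have x0 : 0 < x by near: x; exact: nbhs_pinfty_gt.
have [qroots _] : 
    (forall z, root (q x) z -> exists2 w, root p w & normc (z - w) < 1) /\
    (forall w, root p w -> exists2 z, root (q x) z & normc (w - z) < 1)
  by near: x; exact: near1.
have [_ /(_ w rw)[z rz zw]] : 
    (forall z, root (q x) z -> exists2 w, root p w & normc (z - w) < u) /\
    (forall w, root p w -> exists2 z, root (q x) z & normc (w - z) < u)
  by near: x; exact: near2.
set rho := spectral_radius _.
have rho0 : 0 < rho by exact: spectral_radius_gt0.
have rho_lo : u * expR (gam * x) <= rho.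
  have rz' : root (chi x) ((expR (gam * x))%:C * z).
    move: rz; rewrite !rootE => rz.
    have := horner_scaled_char_poly gam x ((expR (gam * x))%:C * z).
    rewrite mulrA -rmorphM -expRD addNr expR0 mul1r (eqP rz) => /esym/eqP.
    rewrite mulf_eq0 => /orP[|//]; rewrite -normc_eq0 normc_real normr_eq0.
    by rewrite gt_eqF// expR_gt0.
  have := le_spectral_radius rz'; rewrite normcM normc_real ger0_norm ?expR_ge0//.
  apply: le_trans; rewrite mulrC ler_wpM2l ?expR_ge0//.
  have := normcD z (w - z); rewrite addrC subrK /u; move: zw; rewrite /u; lra.
have rho_hi : rho <= B * expR (gam * x).
  have [v rv rhov] := spectral_radius_root (P x).
  have : root (q x) ((expR (- (gam * x)))%:C * v).
    by rewrite rootE horner_scaled_char_poly (rootP rv) mulr0.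
  move=> /qroots[w' rw' w'v].
  have := root_bound mp sp rw'.
  have := normcD ((expR (- (gam * x)))%:C * v - w') w'.
  rewrite subrK normcM normc_real (ger0_norm (expR_ge0 _)) rhov -/rho => h1 h2.
  have : expR (- (gam * x)) * rho <= B.
    by apply: le_trans h1 _; rewrite /B; lra.
  by rewrite expRN mulrC ler_pdivrMr ?expR_gt0.
rewrite -[X in X + _ <= _](mulfK (lt0r_neq0 x0)).
rewrite -[X in _ && (_ <= X + _)](mulfK (lt0r_neq0 x0)).
rewrite -!mulrDl !ler_pM2r ?invr_gt0//.
apply/andP; split.
- rewrite -[X in X + _]expRK -lnM ?posrE ?expR_gt0//.
  by rewrite ler_ln ?posrE ?(mulr_gt0 (expR_gt0 _) u0)// mulrC.
- rewrite -[X in _ <= X + _]expRK -lnM ?posrE ?expR_gt0//.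
  by rewrite ler_ln ?posrE ?(mulr_gt0 (expR_gt0 _) B0)// mulrC.
Unshelve. all: by end_near. Qed.

(** The eigenvalues of P x are the 1 - x mu, where mu runs over the eigenvalues of
    Q x = (1 - P x) / x. The entries of Q x have limits, so the mu approach the roots
    of a limit polynomial p; as |1 - x mu| = 1 - x Re mu + O(x^2), the limit is
    - Re w for a root w of p with the least real part. *)
Lemma ln_spectral_radius_cvg0 : P 0 = 1%:M ->
  exists l : R, ln (spectral_radius (P x)) / x @[x --> (0 : R)^'+] --> l.
Proof.
move=> P0.
pose Q x : 'M[R[i]]_n.+1 := (- (x^-1)%:C) *: (P x - 1%:M).
have Qij i j : exists c, ccvg (0 : R)^'+ (fun x => Q x i j) c.
  have [c hc] := expsum_slope (P_expsum i j); exists (- c).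
  have -> : (fun x => Q x i j) = fun x => -1 * ((P x i j - P 0 i j) * (x^-1)%:C).
    by apply/funext => x; rewrite !mxE P0 !mxE mulN1r mulNr mulrC.
  by rewrite -[X in ccvg _ _ X]mulN1r; apply: ccvgM => //; exact: ccvg_cst.
have [p [mp sp qp]] := limit_poly (fun x => size_char_poly (Q x))
  (fun x => char_poly_monic (Q x)) (fun k => char_poly_coef_cvg _ k Qij).
have [s ps szs] := monic_prod_roots mp.
have s0 : s != [::] by apply/eqP => s0; move: szs; rewrite s0 sp.
have [w ws wmax] := seq_max (fun z => - complex.Re z) s0.
have rootp z : root p z = (z \in s) by rewrite ps root_prod_XsubC.
pose k := complex.Re w; exists (- k).
pose B := 2 + \sum_(j < n.+1) normc p`_j.
have B1 : 2 <= B.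
  have : 0 <= \sum_(j < n.+1) normc p`_j by apply: sumr_ge0 => j _; exact: normc_ge0.
  rewrite /B; lra.
have PQ x z : x != 0 ->
    root (char_poly (P x)) z = root (char_poly (Q x)) ((1 - z) * (x^-1)%:C).
  move=> x0; rewrite -!eigenvalue_root_char.
  have xC : (x^-1)%:C != 0 :> R[i] by rewrite fmorph_eq0 invr_eq0.
  apply/eigenvalueP/eigenvalueP => -[v vE v0]; exists v => //.
    rewrite -scalemxAr mulmxBr mulmx1 vE -[X in _ - X]scale1r -scalerBl scalerA.
    by congr (_ *: _); ring.
  move: vE; rewrite -scalemxAr mulmxBr mulmx1 mulrC -scalerA scaleNr -scalerN.
  move=> /(scalerI xC) /eqP; rewrite scalerBl scale1r opprB (inj_eq (addrI _)) => /eqP.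
  by move=> /oppr_inj.
apply/cvgrPdist_le => e e0.
pose e3 := e / 3.
have e30 : 0 < e3 by rewrite divr_gt0.
have near1 := continuity_of_roots (fun x => size_char_poly (Q x))
  (fun x => char_poly_monic (Q x)) sp mp qp ltr01.
have near2 := continuity_of_roots (fun x => size_char_poly (Q x))
  (fun x => char_poly_monic (Q x)) sp mp qp e30.
have small c d : 0 < d -> \forall x \near (0 : R)^'+, x * c < d.
  move=> d0; have : x * c @[x --> (0 : R)^'+] --> 0 * c.
    by apply: cvgM; [exact: cvg_at_right_filter (@cvg_id _ _)|exact: cvg_cst].
  by rewrite mul0r => /cvgr_lt; apply.
have near3 := small (B ^+ 2) _ e30.
have near4 := small (k + e3) 1 ltr01.
have near5 := small ((k + e3) * (k + e3 + e3)) _ e30.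
near=> x.
have x0 : 0 < x by near: x; exact: nbhs_right_gt.
have [qroots1 _] : 
    (forall z, root (char_poly (Q x)) z -> exists2 w, root p w & normc (z - w) < 1) /\
    (forall w, root p w -> exists2 z, root (char_poly (Q x)) z & normc (w - z) < 1)
  by near: x; exact: near1.
have [qroots2 proots] : 
    (forall z, root (char_poly (Q x)) z -> exists2 w, root p w & normc (z - w) < e3) /\
    (forall w, root p w -> exists2 z, root (char_poly (Q x)) z & normc (w - z) < e3)
  by near: x; exact: near2.
have xs1 : x * B ^+ 2 < e3 by near: x; exact: near3.
have xs2 : x * (k + e3) < 1 by near: x; exact: near4.
have xs3 : x * ((k + e3) * (k + e3 + e3)) < e3 by near: x; exact: near5.
set rho := spectral_radius _.
have rho0 : 0 < rho by exact: spectral_radius_gt0.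
have hi : ln rho <= x * (- k + e3 + e3).
  have [v rv] := spectral_radius_root (P x); rewrite -/rho => rhov.
  move: (rv); rewrite PQ ?gt_eqF//; set mu := (1 - v) * _ => rmu.
  have [w' rw' w'v] := qroots2 _ rmu.
  have muB : normc mu <= B.
    have [w1 rw1 w1v] := qroots1 _ rmu.
    have := normcD (mu - w1) w1; rewrite subrK.
    have := root_bound mp sp rw1; rewrite /B; lra.
  have Rmu : k - e3 <= complex.Re mu.
    have := wmax w'; rewrite -rootp => /(_ rw').
    have := le_lt_trans (Re_le_normc _) w'v; rewrite raddfB /= ltr_norml -/k.
    by move=> /andP[]; lra.
  have vE : v = 1 - x%:C * mu.
    rewrite /mu mulrCA -rmorphM divff ?gt_eqF// mulr1; ring.
  have rho2 : rho ^+ 2 <= 1 + x * (- 2 * (k - e3) + x * B ^+ 2).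
    have -> : rho ^+ 2 = 1 - 2 * x * complex.Re mu + x ^+ 2 * normc mu ^+ 2.
      rewrite -rhov vE; case: (mu) => a b; rewrite /normc /=.
      rewrite !sqr_sqrtr ?addr_ge0 ?sqr_ge0//; ring.
    have h1 : x * (k - e3) <= x * complex.Re mu by rewrite ler_wpM2l// ltW.
    have h2 : x ^+ 2 * normc mu ^+ 2 <= x ^+ 2 * B ^+ 2.
      rewrite ler_wpM2l ?sqr_ge0// lerXn2r ?nnegrE ?normc_ge0//; lra.
    lra.
  have : ln (rho ^+ 2) <= x * (- 2 * (k - e3) + x * B ^+ 2).
    have r2 : 0 < rho ^+ 2 by rewrite exprn_gt0.
    apply: le_trans (le_ln1Dx _); last by lra.
    by rewrite ler_ln ?posrE//; exact: lt_le_trans rho2.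
  rewrite lnXn// mulr2n.
  have : x * (x * B ^+ 2) <= x * e3 by rewrite ler_wpM2l// ltW.
  have : 0 < x * e3 by rewrite mulr_gt0.
  lra.
have lo : x * (- k - e3 - e3) <= ln rho.
  have rw : root p w by rewrite rootp.
  have [mu rmu muw] := proots w rw.
  have rv : root (char_poly (P x)) (1 - x%:C * mu).
    rewrite PQ ?gt_eqF// opprB addrCA subrr addr0 mulrAC -rmorphM divff ?gt_eqF//.
    by rewrite mul1r.
  have Rmu : complex.Re mu <= k + e3.
    have := le_lt_trans (Re_le_normc _) muw; rewrite raddfB /= ltr_norml -/k.
    by move=> /andP[]; lra.
  have rho_lo : 1 - x * (k + e3) <= rho.
    apply: le_trans (le_spectral_radius rv); apply: le_trans (Re_le_normc _).
    rewrite raddfB /= complex_ReM /= mul0r subr0; apply: le_trans (ler_norm _).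
    by rewrite lerD2l lerN2 ler_wpM2l// ltW.
  set y := 1 - x * (k + e3) in rho_lo.
  have y0 : 0 < y by rewrite /y; lra.
  apply: (@le_trans _ _ (ln y)); last by rewrite ler_ln ?posrE.
  have : ln y^-1 <= y^-1 - 1.
    rewrite -{1}[y^-1](subrK 1) addrC; apply: le_ln1Dx.
    by rewrite ltrBrDr addNr invr_gt0.
  rewrite lnV ?posrE// => h.
  have : y^-1 - 1 <= x * (k + e3 + e3).
    rewrite lerBlDr -[leLHS]mul1r ler_pdivrMr//.
    have xs3' : x * (x * ((k + e3) * (k + e3 + e3))) <= x * e3.
      by rewrite ler_wpM2l// ltW.
    rewrite /y; nra.
  lra.
rewrite ler_norml; apply/andP; split.
  rewrite lerBrDl -lerBrDr ler_pdivrMr// mulrC; apply: le_trans hi _.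
  rewrite ler_wpM2l ?(ltW x0)// /e3; lra.
rewrite lerBlDr -lerBlDl ler_pdivlMr// mulrC; apply: le_trans lo.
rewrite ler_wpM2l ?(ltW x0)// /e3; lra.
Unshelve. all: by end_near. Qed.

End SpectralRadiusAsymptotics.

(** * Exponentials of hermitian matrices *)

Section Adjoint.
Variable R : realType.

Lemma ctmxM m n p (A : 'M[R[i]]_(m, n)) (B : 'M[R[i]]_(n, p)) :
  adj (A *m B) = adj B *m adj A.
Proof. by rewrite trmx_mul map_mxM. Qed.

Lemma ctmxK m n (A : 'M[R[i]]_(m, n)) : adj (adj A) = A.
Proof. exact: trmxCK. Qed.

Lemma ctmx1 n : adj (1%:M : 'M[R[i]]_n) = 1%:M.
Proof. by rewrite trmx1 map_mx1. Qed.

Lemma ctmxZ_real m n (c : R) (A : 'M[R[i]]_(m, n)) :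
  adj (c%:C *: A) = c%:C *: adj A.
Proof.
apply/matrixP => i j; rewrite !mxE rmorphM /=; congr (_ * _).
by apply/eqP; rewrite eq_complex /= oppr0 !eqxx.
Qed.

Lemma psd_adj n (A : 'M[R[i]]_n) : psd_hermitian A -> adj A = A.
Proof. by move=> [/is_hermitianmxP]; rewrite expr0 scale1r. Qed.

End Adjoint.

Lemma mulmx_conj (R : comNzRingType) n (U V D E : 'M[R]_n) : U *m V = 1%:M ->
  (V *m D *m U) *m (V *m E *m U) = V *m (D *m E) *m U.
Proof. by move=> UV; rewrite !mulmxA -[_ *m U *m V]mulmxA UV mulmx1. Qed.

Section HermitianExponential.
Variables (R : realType) (n : nat).
Implicit Type A : 'M[R[i]]_n.

Definition herm_eig A (j : 'I_n) : R := complex.Re (spectral_diag A 0 j).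

Definition diag_exp (f : 'I_n -> R) (s : R) : 'M[R[i]]_n :=
  diag_mx (\row_j (expR (- s * f j))%:C).

(** This is exp(- s A) when A is hermitian, written in an eigenbasis: its entries are
    visibly exponential sums in s with real exponents. *)
Definition herm_exp A (s : R) : 'M[R[i]]_n :=
  adj (spectralmx A) *m diag_exp (herm_eig A) s *m spectralmx A.

Lemma spectralmx_adjM A : adj (spectralmx A) *m spectralmx A = 1%:M.
Proof.
by rewrite -invmx_unitary ?spectral_unitarymx// mulVmx// spectral_unit.
Qed.

Lemma spectralmxM_adj A : spectralmx A *m adj (spectralmx A) = 1%:M.
Proof. exact/unitarymxP/spectral_unitarymx. Qed.

Lemma herm_spectral A : adj A = A ->
  A = adj (spectralmx A) *m diag_mx (\row_j (herm_eig A j)%:C) *m spectralmx A.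
Proof.
move=> Aadj; have hA : A \is hermsymmx by apply/is_hermitianmxP; rewrite expr0 scale1r.
have /orthomx_spectralP AE := hermitian_normalmx hA.
rewrite {1}AE (invmx_unitary (spectral_unitarymx A)).
suff -> : \row_j (herm_eig A j)%:C = spectral_diag A by [].
apply/rowP => j; rewrite mxE /herm_eig.
have /mxOverP/(_ 0 j)/complex_realP[x ->] := hermitian_spectral_diag_real hA.
by [].
Qed.

Lemma herm_exp0 A : herm_exp A 0 = 1%:M.
Proof.
rewrite /herm_exp (_ : diag_exp _ 0 = 1%:M) ?mulmx1 ?spectralmx_adjM//.
rewrite /diag_exp (_ : \row_j _ = const_mx 1) ?diag_const_mx//.
by apply/rowP => j; rewrite !mxE oppr0 mul0r expR0.
Qed.

Lemma herm_expD A s t : herm_exp A (s + t) = herm_exp A s *m herm_exp A t.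
Proof.
rewrite /herm_exp.
have -> : diag_exp (herm_eig A) (s + t) =
    diag_exp (herm_eig A) s *m diag_exp (herm_eig A) t.
  rewrite /diag_exp mulmx_diag; congr diag_mx; apply/rowP => j.
  by rewrite !mxE -rmorphM -expRD -mulrDl opprD.
have := spectralmxM_adj A.
move: (spectralmx A) => U.
move: (adj U) => V UV.
by rewrite (mulmx_conj _ _ UV).
Qed.

Lemma herm_exp_adj A s : adj (herm_exp A s) = herm_exp A s.
Proof.
rewrite /herm_exp !ctmxM ctmxK mulmxA.
suff -> : adj (diag_exp (herm_eig A) s) = diag_exp (herm_eig A) s by [].
rewrite /diag_exp tr_diag_mx map_diag_mx; congr diag_mx; apply/rowP => j; rewrite !mxE.
by apply/eqP; rewrite eq_complex /= oppr0 !eqxx.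
Qed.

Lemma herm_exp_expsum A (c : R) i j : is_expsum (fun x => herm_exp A (x * c) i j).
Proof.
rewrite (_ : (fun x => _) = fun x => \sum_k
    (adj (spectralmx A) i k * (expR (- (c * herm_eig A k) * x))%:C * spectralmx A k j)).
  apply: is_expsum_sum => k; apply: is_expsumM; last exact: is_expsum_cst.
  by apply: is_expsumM; [exact: is_expsum_cst|exact: is_expsum_exp].
apply/funext => x; rewrite /herm_exp mxE; apply: eq_bigr => k _.
congr (_ * _); rewrite /diag_exp mul_mx_diag !mxE; congr (_ * (expR _)%:C).
by ring.
Qed.

(** The eigenvalue is the value of the quadratic form of A at the j-th vector of an
    orthonormal eigenbasis. *)
Lemma herm_eig_ge0 A j : psd_hermitian A -> 0 <= herm_eig A j.
Proof.
move=> psdA; have Aadj := psd_adj psdA.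
have [_ /(_ (adj (row j (spectralmx A))))] := psdA.
rewrite ctmxK -row_mul.
have := herm_spectral Aadj; set D := diag_mx _ => AE.
have -> : spectralmx A *m A = D *m spectralmx A.
  by rewrite {2}AE !mulmxA spectralmxM_adj mul1mx.
have -> : adj (row j (spectralmx A)) = adj (spectralmx A) *m delta_mx j 0.
  by rewrite tr_row map_col colE.
rewrite row_mul -mulmxA (mulmxA (spectralmx A)) spectralmxM_adj mul1mx.
by rewrite -colE !mxE eqxx mulr1n lecR.
Qed.

End HermitianExponential.

Section Contraction.
Variables (R : realType) (n : nat).
Implicit Types (v : 'rV[R[i]]_n) (A : 'M[R[i]]_n).

Definition sqnorm v : R := \sum_j normc (v 0 j) ^+ 2.

Lemma sqnormE v : (sqnorm v)%:C = (v *m adj v) 0 0.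
Proof.
rewrite /sqnorm rmorph_sum mxE; apply: eq_bigr => j _ /=; rewrite !mxE.
case: (v 0 j) => a b; rewrite sqr_sqrtr ?addr_ge0 ?sqr_ge0//.
by apply/eqP; rewrite eq_complex /=; apply/andP; split; apply/eqP; ring.
Qed.

Lemma sqnorm_unitary v (U : 'M[R[i]]_n) : U *m adj U = 1%:M ->
  sqnorm (v *m U) = sqnorm v.
Proof.
move=> UU; suff : (sqnorm (v *m U))%:C = (sqnorm v)%:C by move=> [].
by rewrite !sqnormE ctmxM mulmxA -(mulmxA v) UU mulmx1.
Qed.

Lemma herm_exp_contraction v A (s : R) : psd_hermitian A -> 0 <= s ->
  sqnorm (v *m herm_exp A s) <= sqnorm v.
Proof.
move=> psdA s0.
have UU := spectralmxM_adj A.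
have VV : adj (spectralmx A) *m adj (adj (spectralmx A)) = 1%:M.
  by rewrite ctmxK; exact: spectralmx_adjM.
rewrite /herm_exp !mulmxA (sqnorm_unitary _ UU) -[leRHS](sqnorm_unitary _ VV).
move: (v *m _) => u; apply: ler_sum => j _.
rewrite /diag_exp mul_mx_diag !mxE normcM normc_real ger0_norm ?expR_ge0//.
rewrite lerXn2r ?nnegrE ?mulr_ge0 ?normc_ge0 ?expR_ge0//.
rewrite ler_piMr ?normc_ge0// -expR0 ler_expR mulNr oppr_le0.
by rewrite mulr_ge0// herm_eig_ge0.
Qed.

Lemma spectral_radius_le1 m (M : 'M[R[i]]_m.+1) :
  (forall v : 'rV_m.+1, \sum_j normc ((v *m M) 0 j) ^+ 2 <= \sum_j normc (v 0 j) ^+ 2) ->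
  spectral_radius M <= 1.
Proof.
move=> contr; have [z <- [v vM v0]] := spectral_radius_eigen M.
have := contr v; rewrite vM.
have -> : \sum_j normc ((z *: v) 0 j) ^+ 2 = normc z ^+ 2 * \sum_j normc (v 0 j) ^+ 2.
  by rewrite mulr_sumr; apply: eq_bigr => j _; rewrite mxE normcM exprMn.
have v_gt0 : 0 < \sum_j normc (v 0 j) ^+ 2.
  rewrite lt0r sumr_ge0 ?andbT => [|j _]; last by rewrite sqr_ge0.
  apply: contra v0 => /eqP/psumr_eq0P vj0; apply/eqP/rowP => j; rewrite mxE.
  apply: eq0_normc; apply/eqP; have /eqP : normc (v 0 j) ^+ 2 = 0.
    by apply: vj0 => // k _; rewrite sqr_ge0.
  by rewrite expf_eq0.
rewrite -[leRHS]mul1r ler_pM2r// expr_le1//; exact: normc_ge0.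
Qed.

End Contraction.

(** * Derivatives across exceptional points *)

Section PuncturedDerivative.
Variable R : realType.
Implicit Types f g : R -> R.

(** By the mean value theorem the difference quotient of f at x is g c for some c
    between x and x + h, and g is continuous at x. *)
Lemma derive_of_punctured f g (x e : R) : 0 < e ->
  (forall y, 0 < `|y - x| < e -> is_derive y 1 f (g y)) ->
  {for x, continuous f} -> {for x, continuous g} -> is_derive x 1 f (g x).
Proof.
move=> e0 fg cf cg.
have cfy y : `|y - x| < e -> {for y, continuous f}.
  move=> ye; have [->//|yx] := eqVneq y x.
  have yxe : 0 < `|y - x| < e by rewrite normr_gt0 subr_eq0 yx.
  apply: differentiable_continuous; apply/derivable1_diffP.
  exact: (@ex_derive _ _ _ _ _ _ _ (fg y yxe)).
have slope a b : a < b -> (forall y, a <= y <= b -> `|y - x| < e) ->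
    (forall y, a < y < b -> y != x) ->
    exists2 c, a < c < b & f b - f a = g c * (b - a).
  move=> ab abe abx; have [||c] := @MVT _ f g a b ab.
  - move=> y; rewrite in_itv /= => /andP[ay yb]; apply: fg.
    by rewrite normr_gt0 subr_eq0 abx ?ay// abe// !ltW.
  - by apply: continuous_in_subspaceT => y; rewrite inE /= in_itv /= => /abe/cfy.
  - by rewrite in_itv /=; exists c.
have key : h^-1 *: (f (h *: 1 + x) - f x) @[h --> (0 : R)^'] --> g x.
  apply/cvgrPdist_le => d d0.
  have /cvgrPdist_le/(_ d d0)/nbhs_ballP[r /= r0 gr] := cg.
  apply/nbhs_ballP; exists (Num.min r e); first by rewrite /= lt_min r0.
  move=> h; rewrite /ball /= sub0r normrN lt_min => /andP[hr he] h0.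
  have gc c : `|c - x| < r -> `|g x - g c| <= d.
    by move=> cr; apply: gr; rewrite /ball /= distrC.
  move: hr he; rewrite /GRing.scale /= mulr1.
  have [hp|hn|hE] := ltgtP 0 h.
  - rewrite (gtr0_norm hp) => hr he; have [|y|y|c /andP[xc ch]] := slope x (h + x).
    + by rewrite ltrDr.
    + by move=> /andP[xy yh]; rewrite ger0_norm ?subr_ge0//; lra.
    + by move=> /andP[xy _]; rewrite gt_eqF.
    + rewrite addrK => ->; rewrite mulrC mulfK ?gt_eqF//.
      by apply: gc; rewrite ger0_norm ?subr_ge0; lra.
  - rewrite (ltr0_norm hn) => hr he; have [|y|y|c /andP[hc cx]] := slope (h + x) x.
    + by rewrite gtrDr.
    + by move=> /andP[hy yx]; rewrite ler0_norm ?subr_le0//; lra.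
    + by move=> /andP[_ yx]; rewrite lt_eqF.
    + move=> fE; have -> : f (h + x) - f x = g c * h.
        by rewrite -opprB fE; ring.
      rewrite mulrC mulfK ?lt_eqF//.
      by apply: gc; rewrite ler0_norm ?subr_le0; lra.
  - by move: h0; rewrite -hE eqxx.
apply: DeriveDef; first by apply/cvg_ex; exists (g x).
exact: cvg_lim key.
Qed.

End PuncturedDerivative.

(** * Calculus of matrix-valued functions *)

Section MatrixCalculus.
Variable R : realType.

Lemma mx_continuous_at_cst m n (A : 'M[R[i]]_(m, n)) t : mx_continuous_at (fun=> A) t.
Proof. by move=> i j; split; exact: cst_continuous. Qed.

Lemma mx_continuous_atM m n p (A : R -> 'M[R[i]]_(m, n)) (B : R -> 'M[R[i]]_(n, p)) t :
  mx_continuous_at A t -> mx_continuous_at B t ->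
  mx_continuous_at (fun s => A s *m B s) t.
Proof.
move=> cA cB i k.
suff : ccvg (nbhs t) (fun s => (A s *m B s) i k) ((A t *m B t) i k) by [].
rewrite mxE; under eq_fun do rewrite mxE.
by apply: ccvg_sum => j _; apply: ccvgM; [exact: cA|exact: cB].
Qed.

Lemma mx_continuous_atZ m n (f : R -> R) (A : R -> 'M[R[i]]_(m, n)) t :
  {for t, continuous f} -> mx_continuous_at A t ->
  mx_continuous_at (fun s => (f s)%:C *: A s) t.
Proof.
move=> cf cA i j.
suff : ccvg (nbhs t) (fun s => ((f s)%:C *: A s) i j) (((f t)%:C *: A t) i j) by [].
rewrite mxE; under eq_fun do rewrite mxE.
by apply: ccvgM; [exact: ccvg_real|exact: cA].
Qed.

Lemma mx_continuous_at_adj m n (A : R -> 'M[R[i]]_(m, n)) t :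
  mx_continuous_at A t -> mx_continuous_at (fun s => adj (A s)) t.
Proof.
move=> cA i j; have [c1 c2] := cA j i; split.
  have -> : (fun s => complex.Re ((adj (A s)) i j)) = (fun s => complex.Re (A s j i)).
    by apply/funext => s; rewrite !mxE conj_Re.
  exact: c1.
have -> : (fun s => complex.Im ((adj (A s)) i j)) = (fun s => - complex.Im (A s j i)).
  by apply/funext => s; rewrite !mxE conj_Im.
exact: continuousN c2.
Qed.

Lemma mx_continuous_at_comp m n (A : R -> 'M[R[i]]_(m, n)) (g : R -> R) t :
  {for t, continuous g} -> mx_continuous_at A (g t) ->
  mx_continuous_at (fun s => A (g s)) t.
Proof.
move=> cg cA i j; have [c1 c2] := cA i j; split.
  exact: (@continuous_comp _ _ _ g (fun s => complex.Re (A s i j)) t cg c1).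
exact: (@continuous_comp _ _ _ g (fun s => complex.Im (A s i j)) t cg c2).
Qed.

Lemma mx_continuous_at_near m n (A B : R -> 'M[R[i]]_(m, n)) t :
  (\forall s \near t, A s = B s) -> mx_continuous_at A t -> mx_continuous_at B t.
Proof.
move=> AB cA i j.
suff : ccvg (nbhs t) (fun s => B s i j) (B t i j) by [].
rewrite -(nbhs_singleton AB); apply: ccvg_near; last exact: (cA i j).
by apply: filterS AB => s ->.
Qed.

Lemma mx_is_derive_near m n (A B : R -> 'M[R[i]]_(m, n)) t D :
  (\forall s \near t, A s = B s) -> mx_is_derive A t D -> mx_is_derive B t D.
Proof.
move=> AB dA i j; have [d1 d2] := dA i j.
by split; [apply: near_eq_is_derive d1|apply: near_eq_is_derive d2];
  apply: filterS AB => s ->.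
Qed.

Lemma mx_is_derive_cst m n (A : 'M[R[i]]_(m, n)) t : mx_is_derive (fun=> A) t 0.
Proof. by move=> i j; rewrite mxE; split; exact: is_derive_cst. Qed.

Lemma mx_is_deriveM m n p (A : R -> 'M[R[i]]_(m, n)) (B : R -> 'M[R[i]]_(n, p)) t A' B' :
  mx_is_derive A t A' -> mx_is_derive B t B' ->
  mx_is_derive (fun s => A s *m B s) t (A' *m B t + A t *m B').
Proof.
move=> dA dB i k; split.
- have -> : (fun s => complex.Re ((A s *m B s) i k)) =
      \sum_(j < n) (fun s => complex.Re (A s i j) * complex.Re (B s j k)
                           - complex.Im (A s i j) * complex.Im (B s j k)).
    apply/funext => s; rewrite mxE complex_Re_sum fct_sumE; apply: eq_bigr => j _.
    by rewrite complex_ReM.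
  rewrite !mxE complex_ReD !complex_Re_sum -big_split /=; apply: is_derive_sum => j.
  have [a1 a2] := dA i j; have [b1 b2] := dB j k.
  by apply: is_derive_eq; rewrite !complex_ReM /GRing.scale /=; ring.
- have -> : (fun s => complex.Im ((A s *m B s) i k)) =
      \sum_(j < n) (fun s => complex.Re (A s i j) * complex.Im (B s j k)
                           + complex.Im (A s i j) * complex.Re (B s j k)).
    apply/funext => s; rewrite mxE complex_Im_sum fct_sumE; apply: eq_bigr => j _.
    by rewrite complex_ImM.
  rewrite !mxE complex_ImD !complex_Im_sum -big_split /=; apply: is_derive_sum => j.
  have [a1 a2] := dA i j; have [b1 b2] := dB j k.
  by apply: is_derive_eq; rewrite !complex_ImM /GRing.scale /=; ring.
Qed.

Lemma mx_is_derive_adj m n (A : R -> 'M[R[i]]_(m, n)) t A' :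
  mx_is_derive A t A' -> mx_is_derive (fun s => adj (A s)) t (adj A').
Proof.
move=> dA i j; have [d1 d2] := dA j i; rewrite !mxE conj_Re conj_Im; split.
  have -> : (fun s => complex.Re ((adj (A s)) i j)) = (fun s => complex.Re (A s j i)).
    by apply/funext => s; rewrite !mxE conj_Re.
  exact: d1.
have -> : (fun s => complex.Im ((adj (A s)) i j)) = (fun s => - complex.Im (A s j i)).
  by apply/funext => s; rewrite !mxE conj_Im.
exact: is_deriveN d2.
Qed.

Lemma mx_is_derive_comp m n (A : R -> 'M[R[i]]_(m, n)) (g : R -> R) (t : R) A' (d : R) :
  is_derive t 1 g d -> mx_is_derive A (g t) A' ->
  mx_is_derive (fun s => A (g s)) t (d%:C *: A').
Proof.
move=> dg dA i j; have [d1 d2] := dA i j; rewrite !mxE.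
have -> : complex.Re (d%:C * A' i j) = complex.Re (A' i j) * d.
  by rewrite complex_ReM /= mul0r subr0 mulrC.
have -> : complex.Im (d%:C * A' i j) = complex.Im (A' i j) * d.
  by rewrite complex_ImM /= mul0r addr0 mulrC.
split.
  exact: (@is_derive1_comp _ (fun s => complex.Re (A s i j)) g _ _ _ d1 dg).
exact: (@is_derive1_comp _ (fun s => complex.Im (A s i j)) g _ _ _ d2 dg).
Qed.

Lemma mx_is_derive_continuous m n (A : R -> 'M[R[i]]_(m, n)) t A' :
  mx_is_derive A t A' -> mx_continuous_at A t.
Proof.
move=> dA i j; have [d1 d2] := dA i j; split;
  apply: differentiable_continuous; apply/derivable1_diffP.
- exact: (@ex_derive _ _ _ _ _ _ _ d1).
- exact: (@ex_derive _ _ _ _ _ _ _ d2).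
Qed.

Lemma mx_derive_of_punctured m n (A D : R -> 'M[R[i]]_(m, n)) (x e : R) : 0 < e ->
  (forall y, 0 < `|y - x| < e -> mx_is_derive A y (D y)) ->
  mx_continuous_at A x -> mx_continuous_at D x -> mx_is_derive A x (D x).
Proof.
move=> e0 AD cA cD i j; have [a1 a2] := cA i j; have [d1 d2] := cD i j; split.
- apply: (@derive_of_punctured _ _ (fun y => complex.Re (D y i j)) _ _ e0) => //.
  by move=> y /AD /(_ i j)[].
- apply: (@derive_of_punctured _ _ (fun y => complex.Im (D y i j)) _ _ e0) => //.
  by move=> y /AD /(_ i j)[].
Qed.

Lemma mx_is_derive0_cst m n (A : R -> 'M[R[i]]_(m, n)) x y :
  (forall t, mx_is_derive A t 0) -> A x = A y.
Proof.
move=> dA; apply/matrixP => i j; apply/eqP; rewrite eq_complex.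
apply/andP; split; apply/eqP.
  apply: (@is_derive_0_is_cst _ (fun s => complex.Re (A s i j))) => t.
  by have [] := dA t i j; rewrite mxE.
apply: (@is_derive_0_is_cst _ (fun s => complex.Im (A s i j))) => t.
by have [] := dA t i j; rewrite mxE.
Qed.

Lemma herm_exp_derive n (A : 'M[R[i]]_n) (g : R -> R) (t d : R) : adj A = A ->
  is_derive t 1 g d ->
  mx_is_derive (fun s => herm_exp A (g s)) t (- (d%:C *: (A *m herm_exp A (g t)))).
Proof.
move=> Aadj dg.
have dD : mx_is_derive (fun s => diag_exp (herm_eig A) (g s)) t
    (- (d%:C *: (diag_mx (\row_j (herm_eig A j)%:C) *m diag_exp (herm_eig A) (g t)))).
  have de i : is_derive t 1 (expR \o (fun s => - g s * herm_eig A i))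
      (expR (- g t * herm_eig A i) * (- d * herm_eig A i)).
    by apply: is_derive1_comp; apply: is_derive_eq; rewrite /GRing.scale /=; ring.
  move=> i j; rewrite mul_diag_mx !mxE; split.
  - have [<-|ij] := eqVneq i j.
      have -> : (fun s => complex.Re (diag_exp (herm_eig A) (g s) i i)) =
          expR \o (fun s => - g s * herm_eig A i).
        by apply/funext => s; rewrite !mxE eqxx.
      by apply: is_derive_eq; rewrite /=; ring.
    have -> : (fun s => complex.Re (diag_exp (herm_eig A) (g s) i j)) = fun=> 0.
      by apply/funext => s; rewrite !mxE (negPf ij).
    by rewrite mulr0n !mulr0 oppr0; exact: is_derive_cst.
  - have -> : (fun s => complex.Im (diag_exp (herm_eig A) (g s) i j)) = fun=> 0.
      by apply/funext => s; rewrite !mxE; case: eqVneq.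
    by apply: is_derive_eq; case: eqVneq => _ /=; ring.
have := mx_is_deriveM (mx_is_deriveM (mx_is_derive_cst (adj (spectralmx A)) t) dD)
  (mx_is_derive_cst (spectralmx A) t).
rewrite mul0mx add0r mulmx0 addr0; congr mx_is_derive.
have := spectralmxM_adj A; have := herm_spectral Aadj.
rewrite /herm_exp.
move: (diag_mx _) (diag_exp _ _) (spectralmx A) => D E U; move: (adj U) => V AE UV.
by rewrite AE (mulmx_conj _ _ UV) mulmxN mulNmx -scalemxAr -scalemxAl.
Qed.

End MatrixCalculus.

(** * Fundamental solution of a damping with finitely many directions *)

(** The common form of the two types of damping: on the k-th arc of a partition of
    the circle, a is the fixed matrix [dir k] times a scalar weight. The weight is 1
    in the piecewise constant case and a translate of the bump in the other one.
    Only the primitives of the weights enter the solution; they are asked for on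
    a neighbourhood of [0, 2 pi] so that two-sided derivatives make sense at both
    ends. *)
Record directed_damping (R : realType) (n : nat) (a : R -> 'M[R[i]]_n) := DirectedDamping {
  arcs : nat;
  brk : nat -> R;
  dir : nat -> 'M[R[i]]_n;
  wgt : nat -> R -> R;
  prim : nat -> R -> R;
  brk_first : brk 0 = 0;
  brk_last : brk arcs = 2 * pi;
  brk_lt : forall k, (k < arcs)%N -> brk k < brk k.+1;
  dir_psd : forall k, (k < arcs)%N -> psd_hermitian (dir k);
  wgt_ge0 : forall k (x : R), 0 <= wgt k x;
  wgt_continuous : forall k (x : R), {for x, continuous (wgt k)};
  prim_derive : forall k (x : R), -1 < x -> is_derive x 1 (prim k) (wgt k x);
  on_arc : forall k (x : R), (k < arcs)%N -> brk k < x < brk k.+1 ->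
    a x = (wgt k x)%:C *: dir k
}.

Section Fundamental.
Variables (R : realType) (n : nat) (a : R -> 'M[R[i]]_n.+1).
Hypothesis a_circle : circle_fun a.
Variable D : directed_damping a.
Let N := arcs D.
Let b := brk D.
Let T : R := 2 * pi.

Let T0 : 0 < T. Proof. by rewrite mulr_gt0// pi_gt0. Qed.

Lemma brk_le i j : (i <= j)%N -> (j <= N)%N -> b i <= b j.
Proof.
elim: j => [|j IH]; first by rewrite leqn0 => /eqP ->.
rewrite leq_eqVlt => /predU1P[->//|]; rewrite ltnS => ij jN.
by apply: le_trans (IH ij (ltnW jN)) _; exact/ltW/brk_lt.
Qed.

Lemma brk_ge0 k : (k <= N)%N -> 0 <= b k.
Proof. by move=> kN; rewrite -(brk_first D); apply: brk_le. Qed.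

Lemma brk_leT k : (k <= N)%N -> b k <= T.
Proof. by move=> kN; rewrite /T -(brk_last D); apply: brk_le. Qed.

(** Composing with [clamp k] freezes the k-th factor of the solution outside the
    k-th arc; the solution over several arcs is then a plain product, without case
    distinction. *)
Definition clamp k (x : R) : R := Num.max (b k) (Num.min x (b k.+1)).

Lemma clamp_left k x : (k < N)%N -> x <= b k -> clamp k x = b k.
Proof.
move=> kN xb; rewrite /clamp max_l// ge_min xb//.
Qed.

Lemma clamp_right k x : (k < N)%N -> b k.+1 <= x -> clamp k x = b k.+1.
Proof. by move=> kN bx; rewrite /clamp min_r// max_r// ltW// brk_lt. Qed.

Lemma clamp_in k x : b k <= x <= b k.+1 -> clamp k x = x.
Proof. by move=> /andP[bx xb]; rewrite /clamp min_l// max_r. Qed.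

Lemma clamp_ge k x : b k <= clamp k x.
Proof. by rewrite /clamp le_max lexx. Qed.

Lemma clamp_continuous k x : {for x, continuous (clamp k)}.
Proof.
apply: (@continuous_max _ _ (fun=> b k) (fun x => Num.min x (b k.+1))).
  exact: cst_continuous.
by apply: (@continuous_min _ _ id (fun=> b k.+1)) => //; exact: cst_continuous.
Qed.

Definition angle k (x : R) : R := prim D k (clamp k x) - prim D k (b k).

Lemma angle_continuous k x : (k < N)%N -> {for x, continuous (angle k)}.
Proof.
move=> kN; apply: continuousB; last exact: cst_continuous.
apply: (@continuous_comp _ _ _ (clamp k) (prim D k)); first exact: clamp_continuous.
apply: differentiable_continuous; apply/derivable1_diffP.
apply: (@ex_derive _ _ _ _ _ _ _ (prim_derive D k _)).
by apply: lt_le_trans (clamp_ge _ _); rewrite (lt_le_trans _ (brk_ge0 (ltnW kN))).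
Qed.

Lemma angle_left k x : (k < N)%N -> x <= b k -> angle k x = 0.
Proof. by move=> kN xb; rewrite /angle clamp_left// subrr. Qed.

Definition arc_factor mu k x := herm_exp (dir D k) (mu * angle k x).

(** The solution of M' = - mu a M on the first k arcs with M = 1 at 0, constant before 0
    and after the k-th arc. *)
Fixpoint fund0 mu k x : 'M[R[i]]_n.+1 :=
  if k is k'.+1 then arc_factor mu k' x *m fund0 mu k' x else 1%:M.

Lemma arc_factor_inv mu k x : arc_factor mu k x *m adj (arc_factor (- mu) k x) = 1%:M.
Proof. by rewrite /arc_factor herm_exp_adj -herm_expD mulNr subrr herm_exp0. Qed.

(** Each factor is hermitian and changing mu into - mu inverts it, while taking
    adjoints reverses the order of the product. So inverses never have to be
    differentiated. *)
Lemma fund0_inv mu k x : fund0 mu k x *m adj (fund0 (- mu) k x) = 1%:M.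
Proof.
elim: k => [|k IH] /=; first by rewrite ctmx1 mulmx1.
rewrite ctmxM mulmxA -(mulmxA (arc_factor mu k x)) IH mulmx1.
exact: arc_factor_inv.
Qed.

Lemma fund0_left mu k x : (k <= N)%N -> x <= 0 -> fund0 mu k x = 1%:M.
Proof.
elim: k => //= k IH kN x0; rewrite IH ?(ltnW kN)// mulmx1.
by rewrite /arc_factor angle_left ?mulr0 ?herm_exp0// (le_trans x0)// brk_ge0// ltnW.
Qed.

Lemma fund0_right mu k x : (k <= N)%N -> T <= x -> fund0 mu k x = fund0 mu k T.
Proof.
move=> + Tx; elim: k => [//|k IH] kN /=; rewrite (IH (ltnW kN)).
have bT : b k.+1 <= T by exact: brk_leT.
suff -> : arc_factor mu k x = arc_factor mu k T by [].
by rewrite /arc_factor /angle !clamp_right// (le_trans bT).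
Qed.

Lemma arc_factor_continuous mu k x : (k < N)%N -> mx_continuous_at (arc_factor mu k) x.
Proof.
move=> kN.
apply: (@mx_continuous_at_comp _ _ _ (herm_exp (dir D k)) (fun x => mu * angle k x)).
  apply: (@continuousM _ _ (fun=> mu) (angle k)); first exact: cst_continuous.
  exact: angle_continuous.
apply: (@mx_is_derive_continuous _ _ _ (fun s => herm_exp (dir D k) (id s))).
by apply: herm_exp_derive; first exact/psd_adj/dir_psd.
Qed.

Lemma fund0_continuous mu k x : (k <= N)%N -> mx_continuous_at (fund0 mu k) x.
Proof.
elim: k => [|k IH] kN /=; first exact: mx_continuous_at_cst.
by apply: mx_continuous_atM; [exact: arc_factor_continuous|exact: IH (ltnW kN)].
Qed.

Lemma fund0_derive_past mu k x : (k <= N)%N -> b k < x -> mx_is_derive (fund0 mu k) x 0.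
Proof.
elim: k => [|k IH] kN bx /=; first exact: mx_is_derive_cst.
have bx' : b k < x by rewrite (lt_trans _ bx)// brk_lt.
have -> : 0 = 0 *m fund0 mu k x + arc_factor mu k x *m 0 by rewrite mul0mx mulmx0 addr0.
apply: mx_is_deriveM; last exact: IH (ltnW kN) bx'.
pose M := herm_exp (dir D k) (mu * (prim D k (b k.+1) - prim D k (b k))).
apply: mx_is_derive_near (mx_is_derive_cst M x).
near=> s; rewrite /arc_factor /angle clamp_right//.
by near: s; apply: filterS (lt_nbhsr bx) => s; exact: ltW.
Unshelve. all: by end_near. Qed.

Lemma arc_factor_derive mu j x : (j < N)%N -> b j < x < b j.+1 ->
  mx_is_derive (arc_factor mu j) x (- (mu%:C *: a x *m arc_factor mu j x)).
Proof.
move=> jN /andP[bx xb].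
pose g x := mu * (prim D j x - prim D j (b j)).
have dg : is_derive x 1 g (mu * wgt D j x).
  have x1 : -1 < x.
    by apply: lt_trans bx; rewrite (lt_le_trans _ (brk_ge0 (ltnW jN))).
  have dp := prim_derive D j x1.
  by apply: is_derive_eq; rewrite /GRing.scale /=; ring.
have := herm_exp_derive (psd_adj (dir_psd jN)) dg.
have arcE y : b j <= y <= b j.+1 -> arc_factor mu j y = herm_exp (dir D j) (g y).
  by move=> yb; rewrite /arc_factor /angle clamp_in.
have xin : b j <= x <= b j.+1 by rewrite !ltW.
have xin' : brk D j < x < brk D j.+1 by rewrite bx.
rewrite -(arcE x xin) rmorphM /= -scalerA scalemxAl -(on_arc jN xin') scalemxAl.
apply: mx_is_derive_near.
near=> s; rewrite arcE//; apply/andP; split; apply/ltW; near: s.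
  exact: lt_nbhsr.
exact: lt_nbhsl.
Unshelve. all: by end_near. Qed.

Lemma fund0_derive mu j x : (j < N)%N -> b j < x < b j.+1 ->
  mx_is_derive (fund0 mu N) x (- (mu%:C *: a x *m fund0 mu N x)).
Proof.
move=> jN /[dup] xj /andP[bx xb].
have : (j < N)%N by [].
rewrite -/N; elim: {-2}N (leqnn N) => // k IH kN; rewrite ltnS leq_eqVlt.
move=> /predU1P[jk|jk] /=.
  rewrite -jk; have -> : - (mu%:C *: a x *m (arc_factor mu j x *m fund0 mu j x)) =
      - (mu%:C *: a x *m arc_factor mu j x) *m fund0 mu j x + arc_factor mu j x *m 0.
    by rewrite mulmx0 addr0 mulNmx mulmxA.
  apply: mx_is_deriveM; first exact: arc_factor_derive.
  exact: fund0_derive_past (ltnW jN) bx.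
have xk : x < b k by apply: lt_le_trans xb _; exact: brk_le (ltnW kN).
have E s : s < b k -> arc_factor mu k s = 1%:M.
  by move=> sk; rewrite /arc_factor angle_left ?ltW// mulr0 herm_exp0.
have -> : - (mu%:C *: a x *m (arc_factor mu k x *m fund0 mu k x)) =
    0 *m fund0 mu k x + arc_factor mu k x *m - (mu%:C *: a x *m fund0 mu k x).
  by rewrite !E// !mul1mx mul0mx add0r.
apply: mx_is_deriveM; last exact: IH (ltnW kN) jk.
apply: mx_is_derive_near (mx_is_derive_cst 1%:M x).
by apply: filterS (lt_nbhsl xk) => s sk; rewrite E.
Qed.

Definition monodromy mu : 'M[R[i]]_n.+1 := fund0 mu N T.

Lemma monodromy_inv mu : monodromy mu *m adj (monodromy (- mu)) = 1%:M.
Proof. exact: fund0_inv. Qed.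

Lemma monodromy_unit mu : monodromy mu \is a GRing.unit.
Proof. by have /mulmx1_unit[] := monodromy_inv mu. Qed.

Lemma monodromyX_inv mu (m : nat) :
  monodromy mu ^+ m *m adj (monodromy (- mu) ^+ m) = 1%:M.
Proof.
elim: m => [|m IH]; first by rewrite !expr0 ctmx1 mulmx1.
rewrite exprSr exprSr -!mulmxE ctmxM mulmxA.
rewrite -(mulmxA (_ ^+ m)) (monodromy_inv mu) mulmx1; exact: IH.
Qed.

Lemma adj_monodromyX mu (k : int) :
  adj (monodromy (- mu) ^ k) = monodromy mu ^ (- k).
Proof.
have inv_of nu (m : nat) : adj (monodromy (- nu) ^+ m) = monodromy nu ^- m.
  have uX := unitrX m (monodromy_unit nu).
  by apply: (mulrI uX); rewrite mulrV//; exact: monodromyX_inv.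
case: (intP k) => [|m|m]; first by rewrite oppr0 !expr0z ctmx1.
  by rewrite -exprnN -exprnP inv_of.
rewrite opprK -exprnN -exprnP; have := inv_of (- mu) m.+1.
by rewrite opprK => <-; rewrite ctmxK.
Qed.

(** The solution on the universal cover: full turns contribute powers, possibly
    negative, of the monodromy. *)
Definition fund mu x : 'M[R[i]]_n.+1 :=
  let k := Num.floor (x / T) in fund0 mu N (x - k%:~R * T) * monodromy mu ^ k.

Lemma fund_inv mu x : fund mu x *m adj (fund (- mu) x) = 1%:M.
Proof.
rewrite /fund /= -!mulmxE ctmxM mulmxA -(mulmxA (fund0 _ _ _)) adj_monodromyX.
have -> : monodromy mu ^ Num.floor (x / T) *m monodromy mu ^ (- Num.floor (x / T)) = 1%:M.
  by rewrite mulmxE -exprzDr ?monodromy_unit// subrr expr0z.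
rewrite mulmx1; exact: fund0_inv.
Qed.

Lemma floor_periodP x : let k := Num.floor (x / T) in
  k%:~R * T <= x < (k + 1)%:~R * T.
Proof. by rewrite /= -ler_pdivlMr// -ltr_pdivrMr// floor_itv. Qed.

Lemma fundE mu x (k : int) : k%:~R * T <= x <= (k + 1)%:~R * T ->
  fund mu x = fund0 mu N (x - k%:~R * T) * monodromy mu ^ k.
Proof.
move=> /andP[kx]; rewrite le_eqVlt => /predU1P[->|xk]; last first.
  rewrite /fund; suff -> : Num.floor (x / T) = k by [].
  by apply: floor_def; rewrite ler_pdivlMr// ltr_pdivrMr// kx.
rewrite /fund mulfK ?gt_eqF// intrKfloor subrr fund0_left//.
have -> : (k + 1)%:~R * T - k%:~R * T = T by rewrite intrD; ring.
transitivity (monodromy mu ^ (k + 1)); first exact: mul1r.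
by rewrite addrC exprzDr ?monodromy_unit// expr1z.
Qed.

(** Since [fund0] is frozen outside the first turn, one formula covers a
    neighbourhood of every multiple of 2 pi, where the floor jumps. *)
Lemma fund_local mu x (k : int) : (k - 1)%:~R * T <= x <= (k + 1)%:~R * T ->
  fund mu x = fund0 mu N (x - k%:~R * T) * fund0 mu N (x - (k - 1)%:~R * T)
    * monodromy mu ^ (k - 1).
Proof.
move=> /andP[k1x xk1]; have [xk|kx] := leP x (k%:~R * T).
  rewrite (@fundE _ _ (k - 1)) ?subrK ?k1x// [X in _ = X * _ * _]fund0_left ?subr_le0//.
  by rewrite mul1r.
rewrite (@fundE _ _ k) ?(ltW kx)// [X in _ = _ * X * _]fund0_right//.
  rewrite -mulrA; congr (_ * _); rewrite -/(monodromy mu).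
  by rewrite -{2}[monodromy mu]expr1z -exprzDr ?monodromy_unit// addrC subrK.
by rewrite lerBrDl intrB mulrBl mul1r subrK ltW.
Qed.

Lemma fund_continuous mu x : mx_continuous_at (fund mu) x.
Proof.
pose k := Num.floor (x / T); have /andP[kx xk] := floor_periodP x.
apply: (@mx_continuous_at_near _ _ _ (fun x => fund0 mu N (x - k%:~R * T) *m
    fund0 mu N (x - (k - 1)%:~R * T) *m monodromy mu ^ (k - 1))).
  near=> y; rewrite (@fund_local _ _ k)//; apply/andP; split; apply/ltW; near: y.
    by apply: lt_nbhsr; apply: lt_le_trans kx; rewrite ltr_pM2r// ltr_int ltrBlDr ltrDl.
  exact: lt_nbhsl.
apply: mx_continuous_atM; last exact: mx_continuous_at_cst.
by apply: mx_continuous_atM; (apply: (@mx_continuous_at_comp _ _ _ (fund0 mu N));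
  [apply: continuousB => //; exact: cst_continuous|exact: fund0_continuous]).
Unshelve. all: by end_near. Qed.

Definition in_arc (y : R) := exists k : int, exists2 j, (j < N)%N &
  b j < y - k%:~R * T < b j.+1.

Lemma a_period (k : int) x : a (x + k%:~R * T) = a x.
Proof.
have nat_period (m : nat) y : a (y + m%:R * T) = a y.
  elim: m y => [|m IH] y; first by rewrite mul0r addr0.
  by rewrite -natr1 mulrDl mul1r addrA a_circle IH.
case: (intP k) => [|m|m]; first by rewrite mul0r addr0.
  exact: nat_period.
by rewrite -(nat_period m.+1) mulrNz mulNr subrK.
Qed.

Lemma near_shift (x c : R) (P : R -> Prop) :
  (\forall z \near x - c, P z) -> \forall y \near x, P (y - c).
Proof.
move=> H; have : (fun y => y - c) @ x --> x - c.
  by apply: cvgB; [exact: cvg_id|exact: cvg_cst].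
by move=> /(_ _ H).
Qed.

Lemma in_arc_continuous y : in_arc y -> mx_continuous_at a y.
Proof.
move=> [k [j jN /andP[yj jy]]].
apply: (@mx_continuous_at_near _ _ _ (fun y => (wgt D j (y - k%:~R * T))%:C *: dir D j)).
  near=> z; rewrite -(on_arc jN) ?a_period.
    by rewrite -{2}[z](subrK (k%:~R * T)) a_period.
  apply/andP; split; near: z.
    by apply: (@near_shift y _ (fun u => b j < u)); exact: lt_nbhsr.
  by apply: (@near_shift y _ (fun u => u < b j.+1)); exact: lt_nbhsl.
apply: mx_continuous_atZ; last exact: mx_continuous_at_cst.
apply: (@continuous_comp _ _ _ (fun y => y - k%:~R * T) (wgt D j)).
  by apply: continuousB => //; exact: cst_continuous.
exact: wgt_continuous.
Unshelve. all: by end_near. Qed.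

Lemma in_arc_derive mu y : in_arc y ->
  mx_is_derive (fund mu) y (- (mu%:C *: a y *m fund mu y)).
Proof.
move=> [k [j jN /[dup] yjk /andP[yj jy]]].
have loc z : b j < z - k%:~R * T < b j.+1 ->
    fund mu z = fund0 mu N (z - k%:~R * T) *m monodromy mu ^ k.
  move=> /andP[zj jz]; apply: fundE; rewrite -subr_ge0; apply/andP; split.
    exact: le_trans (brk_ge0 (ltnW jN)) (ltW zj).
  by rewrite intrD mulrDl mul1r -lerBlDl (le_trans (ltW jz))// brk_leT.
rewrite loc//.
apply: (@mx_is_derive_near _ _ _ (fun z => fund0 mu N (z - k%:~R * T) *m monodromy mu ^ k)).
  near=> z; rewrite loc//; apply/andP; split; near: z.
    by apply: (@near_shift y _ (fun u => b j < u)); exact: lt_nbhsr.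
  by apply: (@near_shift y _ (fun u => u < b j.+1)); exact: lt_nbhsl.
have -> : a y = a (y - k%:~R * T) by rewrite -{1}[y](subrK (k%:~R * T)) a_period.
have ds : is_derive y 1 (fun z => z - k%:~R * T) (1 : R).
  by apply: is_derive_eq; rewrite subr0.
have := mx_is_deriveM (mx_is_derive_comp ds (fund0_derive mu jN yjk))
  (mx_is_derive_cst (monodromy mu ^ k) y).
by rewrite mulmx0 addr0 scale1r mulNmx mulmxA.
Unshelve. all: by end_near. Qed.

Lemma find_arc_right x : 0 <= x < T -> exists2 j, (j < N)%N & b j <= x < b j.+1.
Proof.
move=> /andP[x0]; rewrite /T -(brk_last D).
suff H k : (k <= N)%N -> x < b k -> exists2 j, (j < N)%N & b j <= x < b j.+1.
  exact: H (leqnn N).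
elim: k => [_|k IH kN xk]; first by rewrite /b (brk_first D) ltNge x0.
have [kx|xk'] := leP (b k) x; first by exists k => //; rewrite kx.
exact: IH (ltnW kN) xk'.
Qed.

Lemma find_arc_left x : 0 < x <= T -> exists2 j, (j < N)%N & b j < x <= b j.+1.
Proof.
move=> /andP[x0]; rewrite /T -(brk_last D).
suff H k : (k <= N)%N -> x <= b k -> exists2 j, (j < N)%N & b j < x <= b j.+1.
  exact: H (leqnn N).
elim: k => [_|k IH kN xk]; first by rewrite /b (brk_first D) leNgt x0.
have [xk'|kx] := leP x (b k); first exact: IH (ltnW kN) xk'.
by exists k => //; rewrite kx.
Qed.

(** Breakpoints are isolated. The arc to the right of x is found from the floor of
    x / (2 pi), the one to the left from its ceiling. *)
Lemma in_arc_punctured x : exists2 e, 0 < e & forall y, 0 < `|y - x| < e -> in_arc y.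
Proof.
have [er er0 right] : exists2 e, 0 < e & forall y, x < y < x + e -> in_arc y.
  pose k := Num.floor (x / T); have /andP[kx xk] := floor_periodP x.
  have [|j jN /andP[jx xj]] := @find_arc_right (x - k%:~R * T).
    by rewrite subr_ge0 kx ltrBlDr -[X in _ < X + _]mul1r -mulrDl addrC -intrD1.
  exists (b j.+1 - (x - k%:~R * T)); first by rewrite subr_gt0.
  by move=> y /andP[xy ye]; exists k, j => //; apply/andP; split; lra.
have [el el0 left] : exists2 e, 0 < e & forall y, x - e < y < x -> in_arc y.
  pose k := Num.ceil (x / T) - 1.
  have /andP[kx xk] : k%:~R * T < x <= k%:~R * T + T.
    have cE : (Num.ceil (x / T))%:~R = k%:~R + 1 :> R by rewrite /k intrB subrK.
    by have := ceil_itv (x / T); rewrite cE ltr_pdivlMr// ler_pdivrMr// mulrDl mul1r.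
  have [|j jN /andP[jx xj]] := @find_arc_left (x - k%:~R * T).
    by rewrite subr_gt0 kx lerBlDl.
  exists (x - k%:~R * T - b j); first by rewrite subr_gt0.
  by move=> y /andP[xy ye]; exists k, j => //; apply/andP; split; lra.
exists (Num.min er el); first by rewrite lt_min er0.
move=> y; rewrite lt_min => /andP[]; rewrite normr_gt0 subr_eq0 => yx /andP[].
have [xy|yx'|xy] := ltgtP x y; last by rewrite xy eqxx in yx.
- by rewrite ger0_norm ?subr_ge0 ?ltW// => yer _; apply: right; rewrite xy/=; lra.
- by rewrite ler0_norm ?subr_le0 ?ltW// => _ yel; apply: left; rewrite yx' andbT; lra.
Qed.

(** The equation is clear inside the arcs. At a breakpoint where a happens to be
    continuous it follows from [mx_derive_of_punctured], both sides being continuous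
    there. *)
Lemma fund_derive mu x : mx_continuous_at a x ->
  mx_is_derive (fund mu) x (- (mu%:C *: a x *m fund mu x)).
Proof.
move=> ca; have [e e0 arc] := in_arc_punctured x.
apply: (@mx_derive_of_punctured _ _ _ _ (fun x => - (mu%:C *: a x *m fund mu x)) _ e) => //.
- by move=> y /arc; exact: in_arc_derive.
- exact: fund_continuous.
- have -> : (fun x => - (mu%:C *: a x *m fund mu x)) =
      (fun x => ((- mu)%:C *: a x) *m fund mu x).
    by apply/funext => y; rewrite rmorphN /= scaleNr mulNmx.
  apply: mx_continuous_atM; last exact: fund_continuous.
  by apply: mx_continuous_atZ => //; exact: cst_continuous.
Qed.

End Fundamental.

(** * Identification of the propagator *)

Section Propagator.
Variables (R : realType) (n : nat) (a : R -> 'M[R[i]]_n.+1).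
Hypothesis a_damping : damping a.
Variable D : directed_damping a.
Let a_circle : circle_fun a := a_damping.1.
Let T : R := 2 * pi.
Let T0 : 0 < T. Proof. by rewrite mulr_gt0// pi_gt0. Qed.

Lemma fund_inv_left mu x : adj (fund D (- mu) x) *m fund D mu x = 1%:M.
Proof. exact/mulmx1C/fund_inv. Qed.

(** The transfer matrix from x to y, fund(y) fund(x)^-1. Moving
    forward the propagator is this matrix for mu = lam; moving backward the sign of
    the equation changes and mu = - lam. *)
Definition transfer mu x y := fund D mu y *m adj (fund D (- mu) x).

Lemma transferK mu x y : transfer mu x y *m transfer mu y x = 1%:M.
Proof.
rewrite /transfer mulmxA -(mulmxA (fund D mu y)) fund_inv_left mulmx1.
exact: fund_inv.
Qed.

Lemma transfer_adj mu x y : adj (transfer mu x y) = transfer (- mu) y x.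
Proof. by rewrite /transfer ctmxM ctmxK opprK. Qed.

Variables (lam : R) (z : R * R).
Hypotheses (lam0 : 0 < lam) (zS : cosphere z).
Let sg := 2 * z.2.
Let ax t := scale_damping lam a (geodesic_flow t z).1.

Lemma sg_sqr : sg * sg = 1.
Proof.
have z2 : z.2 ^+ 2 = 1 / 4.
  by rewrite -real_normK ?num_real// zS; field.
rewrite /sg; transitivity (4 * z.2 ^+ 2); first ring.
by rewrite z2; field.
Qed.

Lemma sg_cases : sg = 1 \/ sg = - 1.
Proof.
have /eqP : sg ^+ 2 = 1 by rewrite expr2 sg_sqr.
by rewrite sqrf_eq1 => /orP[]/eqP ->; [left|right].
Qed.

Lemma axE t : ax t = lam%:C *: a (z.1 + sg * t).
Proof. by []. Qed.

Lemma affine_continuous t : {for t, continuous (fun t => z.1 + sg * t)}.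
Proof.
apply: continuousD; first exact: cst_continuous.
apply: (@continuousM _ _ (fun=> sg) id) => //; exact: cst_continuous.
Qed.

Lemma affine_derive (t : R) : is_derive t 1 (fun t => z.1 + sg * t) sg.
Proof. by apply: is_derive_eq; rewrite /GRing.scale /=; ring. Qed.

Lemma ax_continuous t :
  mx_continuous_at ax t <-> mx_continuous_at a (z.1 + sg * t).
Proof.
split => [cax|ca]; last first.
  apply: mx_continuous_atZ; first exact: cst_continuous.
  by apply: (mx_continuous_at_comp (g := fun t => z.1 + sg * t)) ca;
    exact: affine_continuous.
have E y : a y = (lam^-1)%:C *: ax (sg * (y - z.1)).
  rewrite axE scalerA -rmorphM mulVf ?gt_eqF// scale1r mulrA sg_sqr mul1r.
  by rewrite addrC subrK.
have -> : a = fun y => (lam^-1)%:C *: ax (sg * (y - z.1)) by apply/funext.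
apply: mx_continuous_atZ; first exact: cst_continuous.
apply: (@mx_continuous_at_comp _ _ _ ax (fun y => sg * (y - z.1))).
  apply: (@continuousM _ _ (fun=> sg) (fun y => y - z.1)); first exact: cst_continuous.
  by apply: continuousB; [exact: cvg_id|exact: cst_continuous].
by rewrite addrC addKr mulrA sg_sqr mul1r.
Qed.

Lemma transfer_is_propagator :
  is_propagator (scale_damping lam a) z (fun t => transfer (sg * lam) z.1 (z.1 + sg * t)).
Proof.
split.
- by rewrite mulr0 addr0; exact: fund_inv.
- move=> t; apply: mx_continuous_atM; last exact: mx_continuous_at_cst.
  apply: (@mx_continuous_at_comp _ _ _ (fund D (sg * lam)) (fun t => z.1 + sg * t)).
    exact: affine_continuous.
  exact: fund_continuous.
- move=> t; rewrite -/(ax _) => /ax_continuous ca.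
  have := mx_is_deriveM (mx_is_derive_comp (affine_derive t)
    (fund_derive a_circle D (sg * lam) ca)) (mx_is_derive_cst (adj (fund D (- (sg * lam)) z.1)) t).
  congr mx_is_derive; rewrite mulmx0 addr0 -/(ax t) axE /transfer.
  rewrite scalerN mulNmx mulmxA; congr (- (_ *m _)).
  by rewrite scalemxAl scalerA -rmorphM mulrA sg_sqr mul1r.
Qed.

(** For the inverse H of the transfer matrix, H G has derivative 0 off a discrete
    set by the two equations, hence everywhere by [mx_derive_of_punctured], so it is
    constant. The hermitian symmetry of a enters the equation H' = H a. *)
Lemma propagator_unique (G : R -> 'M[R[i]]_n.+1) :
  is_propagator (scale_damping lam a) z G ->
  G = fun t => transfer (sg * lam) z.1 (z.1 + sg * t).
Proof.
move=> [G0 cG dG]; apply/funext => t.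
pose H t := transfer (sg * lam) (z.1 + sg * t) z.1.
have cH s : mx_continuous_at H s.
  apply: mx_continuous_atM; first exact: mx_continuous_at_cst.
  apply: mx_continuous_at_adj.
  apply: (@mx_continuous_at_comp _ _ _ (fund D (- (sg * lam))) (fun t => z.1 + sg * t)).
    exact: affine_continuous.
  exact: fund_continuous.
have dH s : mx_continuous_at ax s -> mx_is_derive H s (H s *m ax s).
  move=> /ax_continuous ca.
  have dF := mx_is_derive_adj (mx_is_derive_comp (affine_derive s)
    (fund_derive a_circle D (- (sg * lam)) ca)).
  have := mx_is_deriveM (mx_is_derive_cst (fund D (sg * lam) z.1) s) dF.
  congr mx_is_derive; rewrite mul0mx add0r /H /transfer -mulmxA axE.
  have aE : adj (a (z.1 + sg * s)) = a (z.1 + sg * s) by apply/psd_adj; exact: a_damping.2.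
  rewrite rmorphN /= scaleNr mulNmx opprK -scalemxAl scalerA -rmorphM mulrA sg_sqr mul1r.
  by rewrite ctmxZ_real ctmxM aE scalemxAr.
have dHG s : mx_is_derive (fun s => H s *m G s) s 0.
  have [e e0 arc] := in_arc_punctured D (z.1 + sg * s).
  apply: (@mx_derive_of_punctured _ _ _ _ (fun=> 0) s e e0).
  - move=> y ye.
    have cax : mx_continuous_at ax y.
      apply/ax_continuous; apply: (in_arc_continuous a_circle); apply: arc.
      have -> : z.1 + sg * y - (z.1 + sg * s) = sg * (y - s) by ring.
      rewrite normrM.
      have -> : `|sg| = 1 by case: sg_cases => ->; rewrite ?normrN normr1.
      by rewrite mul1r.
    have := mx_is_deriveM (dH y cax) (dG y cax).
    have cancel (X Y Z : 'M[R[i]]_n.+1) : X *m Y *m Z + X *m - (Y *m Z) = 0.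
      by rewrite mulmxN mulmxA subrr.
    by rewrite (cancel (H y) (ax y) (G y)).
  - exact: mx_continuous_atM.
  - exact: mx_continuous_at_cst.
have HG1 : H t *m G t = 1%:M.
  rewrite (mx_is_derive0_cst t 0 dHG) /H G0 mulmx1 mulr0 addr0; exact: fund_inv.
have cancel (X Y Z : 'M[R[i]]_n.+1) : X *m Y = 1%:M -> Y *m Z = 1%:M -> Z = X.
  by move=> XY YZ; rewrite -[Z]mul1mx -XY -mulmxA YZ mulmx1.
exact: cancel (transferK (sg * lam) z.1 (z.1 + sg * t)) HG1.
Qed.

Lemma propagatorE t :
  propagator (scale_damping lam a) t z = transfer (sg * lam) z.1 (z.1 + sg * t).
Proof.
rewrite /propagator (_ : xget _ _ = fun t => transfer (sg * lam) z.1 (z.1 + sg * t))//.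
by apply: xget_unique; [exact: transfer_is_propagator|exact: propagator_unique].
Qed.

End Propagator.

(** * Comparison of operator norms *)

Section OperatorNorm.
Variables (R : realType) (n : nat).
Implicit Types (A : 'M[R[i]]_n) (v : 'cV[R[i]]_n).

Lemma normc_le_enorm v i : normc (v i 0) <= enorm v.
Proof.
rewrite -[leLHS]ger0_norm ?normc_ge0// -sqrtr_sqr ler_sqrt.
  by rewrite (bigD1 i)//= lerDl sumr_ge0// => j _; rewrite sqr_ge0.
by rewrite sumr_ge0// => j _; rewrite sqr_ge0.
Qed.

Lemma enorm_le v : enorm v <= \sum_i normc (v i 0).
Proof.
have s0 : 0 <= \sum_i normc (v i 0) by apply: sumr_ge0 => i _; exact: normc_ge0.
rewrite -[leRHS]ger0_norm// -sqrtr_sqr ler_sqrt ?sqr_ge0// expr2 mulr_suml.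
apply: ler_sum => i _; rewrite expr2 ler_wpM2l ?normc_ge0//.
by rewrite (bigD1 i)//= lerDl sumr_ge0// => j _; exact: normc_ge0.
Qed.

Lemma enorm_mulmx_le A v : enorm v <= 1 -> enorm (A *m v) <= mxnorm1 A.
Proof.
move=> v1; apply: le_trans (enorm_le _) _; apply: ler_sum => i _.
rewrite mxE; apply: le_trans (normc_sum _ _ _) _; apply: ler_sum => j _.
rewrite normcM ler_piMr ?normc_ge0// (le_trans (normc_le_enorm _ _))//.
Qed.

Lemma opnorm_le A : opnorm A <= mxnorm1 A.
Proof.
apply: ge_sup; last by move=> _ [v v1 <-]; exact: enorm_mulmx_le.
exists (enorm (A *m 0)), 0 => //=; rewrite /enorm big1 ?sqrtr0 ?ler01// => i _.
by rewrite mxE normc0 expr0n.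
Qed.

Lemma opnorm_ge A : mxnorm1 A <= (n * n)%:R * opnorm A.
Proof.
have entry i j : normc (A i j) <= opnorm A.
  have -> : A i j = (A *m delta_mx j (0 : 'I_1)) i 0 by rewrite -colE mxE.
  apply: le_trans (normc_le_enorm _ _) _; apply: ub_le_sup.
    by exists (mxnorm1 A) => _ [v v1 <-]; exact: enorm_mulmx_le.
  exists (delta_mx j 0) => //=; rewrite /enorm (bigD1 j)//= mxE !eqxx big1 => [|k kj].
    by rewrite normc1 expr1n addr0 sqrtr1.
  by rewrite mxE (negPf kj) normc0 expr0n.
rewrite natrM -mulrA; apply: (@le_trans _ _ (\sum_(i < n) \sum_(j < n) opnorm A)).
  by apply: ler_sum => i _; apply: ler_sum => j _.
by rewrite !sumr_const !card_ord !mulr_natl.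
Qed.

End OperatorNorm.

(** * The damping rate as a spectral radius *)

Section DampingRate.
Variables (R : realType) (n : nat) (a : R -> 'M[R[i]]_n.+1).
Hypothesis a_damping : damping a.
Variable D : directed_damping a.
Let a_circle : circle_fun a := a_damping.1.
Let N := arcs D.
Let T : R := 2 * pi.
Let T0 : 0 < T. Proof. by rewrite mulr_gt0// pi_gt0. Qed.

(** [fund0] is continuous on [0, 2 pi] and constant on either side. *)
Lemma fund0_bounded mu : exists2 K, 0 < K & forall x, mxnorm1 (fund0 D mu N x) <= K.
Proof.
pose f x := \sum_(i < n.+1) \sum_(j < n.+1)
  (`|complex.Re (fund0 D mu N x i j)| + `|complex.Im (fund0 D mu N x i j)|).
have cf : {within `[0, T], continuous f}.
  apply: continuous_subspaceT => x.
  have c := @fund0_continuous _ _ _ D mu N x (leqnn N).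
  apply: cvg_sumr => i; apply: cvg_sumr => j; have [c1 c2] := c i j.
  by apply: cvgD; apply: cvg_norm.
have [x0 _ x0max] := EVT_max (ltW T0) cf.
have fpos x : 0 <= f x.
  by apply: sumr_ge0 => i _; apply: sumr_ge0 => j _; rewrite addr_ge0.
have nf x : mxnorm1 (fund0 D mu N x) <= f x.
  by apply: ler_sum => i _; apply: ler_sum => j _; exact: normc_le_ReIm.
exists (1 + f x0); first by rewrite ltr_pwDl.
move=> x; have [x1|x1] := leP x 0.
  rewrite fund0_left// -(fund0_left (D := D) mu (leqnn N) (lexx 0)).
  apply: le_trans (nf _) _; apply: le_trans (x0max 0 _) _.
    by rewrite in_itv /= lexx ltW.
  by rewrite lerDr.
have [x2|x2] := leP T x.
  rewrite fund0_right//; apply: le_trans (nf _) _; apply: le_trans (x0max T _) _.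
    by rewrite in_itv /= lexx ltW.
  by rewrite lerDr.
apply: le_trans (nf _) _; apply: le_trans (x0max x _) _.
  by rewrite in_itv /= !ltW.
by rewrite lerDr.
Qed.

(** m is the difference of the integer parts of y / (2 pi) and x / (2 pi), hence within 1 of
    (y - x) / (2 pi). *)
Lemma transferE mu x y : x <= y -> exists2 m : nat, `|m%:R - (y - x) / T| <= 1 &
  exists u v, transfer D mu x y =
    fund0 D mu N u *m monodromy D mu ^+ m *m adj (fund0 D (- mu) N v).
Proof.
move=> xy; pose k := Num.floor (x / T); pose l := Num.floor (y / T).
have /andP[k1 k2] := floor_itv (x / T); have /andP[l1 l2] := floor_itv (y / T).
have kl : k <= l by apply: le_floor; rewrite ler_pM2r ?invr_gt0.
have [m mE] : exists m : nat, l - k = m%:Z.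
  by exists `|l - k|%N; rewrite gez0_abs// subr_ge0.
exists m.
  have -> : m%:R = l%:~R - k%:~R :> R by rewrite -intrB mE.
  rewrite -/k -/l in k1 k2 l1 l2.
  rewrite intrD in k2; rewrite intrD in l2.
  by rewrite mulrBl ler_norml; apply/andP; split; lra.
exists (y - l%:~R * T), (x - k%:~R * T).
rewrite /transfer /fund -/k -/l -!mulmxE ctmxM adj_monodromyX !mulmxA; congr (_ *m _).
by rewrite -mulmxA; congr (_ *m _); rewrite mulmxE -exprzDr ?monodromy_unit// mE.
Qed.

(** Replacing the number m of turns by the real number s costs at most a factor
    max(r, 1/r) either way. *)
Lemma exp_turns (r : R) (m : nat) (s : R) : 0 < r -> `|m%:R - s| <= 1 ->
  expR (- `|ln r|) * expR (s * ln r) <= r ^+ m <= expR `|ln r| * expR (s * ln r).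
Proof.
move=> r0 ms; have -> : r ^+ m = expR (m%:R * ln r) by rewrite expRM_natl lnK.
have : `|(m%:R - s) * ln r| <= `|ln r| by rewrite normrM ler_piMl.
rewrite ler_norml => /andP[h1 h2].
by rewrite -!expRD !ler_expR; apply/andP; split; lra.
Qed.

Lemma transfer_upper mu r : spectral_radius (monodromy D mu) < r ->
  exists2 C, 0 < C & forall x y, x <= y ->
    mxnorm1 (transfer D mu x y) <= C * expR ((y - x) / T * ln r).
Proof.
move=> rho_r; have r0 : 0 < r by apply: le_lt_trans rho_r; exact: spectral_radius_ge0.
have [c c0 pow] := spectral_radius_power_ub rho_r.
have [K K0 bK] := fund0_bounded mu; have [L L0 bL] := fund0_bounded (- mu).
exists (K * c * expR `|ln r| * L); first by rewrite !mulr_gt0// expR_gt0.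
move=> x y /(transferE mu)[m ms [u [v ->]]].
have /andP[_ rm] := exp_turns r0 ms.
apply: le_trans (mxnorm1M _ _) _; rewrite mxnorm1_adj.
have -> : K * c * expR `|ln r| * L * expR ((y - x) / T * ln r) =
    K * (c * (expR `|ln r| * expR ((y - x) / T * ln r))) * L by ring.
rewrite ler_pM ?mxnorm1_ge0//.
apply: le_trans (mxnorm1M _ _) _; rewrite ler_pM ?mxnorm1_ge0//.
by apply: le_trans (pow m) _; rewrite ler_pM2l.
Qed.

Lemma transfer_lower mu : exists2 c, 0 < c & forall x y, x <= y ->
  c * expR ((y - x) / T * ln (spectral_radius (monodromy D mu))) <=
    mxnorm1 (transfer D mu x y).
Proof.
set r := spectral_radius _.
have r0 : 0 < r by exact/spectral_radius_gt0/monodromy_unit.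
have [K K0 bK] := fund0_bounded mu; have [L L0 bL] := fund0_bounded (- mu).
exists (expR (- `|ln r|) / (K * L)).
  by rewrite divr_gt0 ?expR_gt0// mulr_gt0.
move=> x y /(transferE mu)[m ms [u [v tE]]].
have /andP[rm _] := exp_turns r0 ms.
rewrite mulrAC ler_pdivrMr ?mulr_gt0//; apply: le_trans rm _.
apply: le_trans (spectral_radius_power_lb _ _) _.
have -> : monodromy D mu ^+ m =
    adj (fund0 D (- mu) N u) *m transfer D mu x y *m fund0 D mu N v.
  rewrite tE !mulmxA.
  rewrite (mulmx1C (fund0_inv D mu N u)) mul1mx -mulmxA (mulmx1C (fund0_inv D mu N v)).
  by rewrite mulmx1.
apply: (@le_trans _ _ (L * mxnorm1 (transfer D mu x y) * K)).
  apply: le_trans (mxnorm1M _ _) _; rewrite ler_pM ?mxnorm1_ge0//.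
  by apply: le_trans (mxnorm1M _ _) _; rewrite mxnorm1_adj ler_pM ?mxnorm1_ge0.
by move: (mxnorm1 _) => X; rewrite mulrC mulrA (mulrC X).
Qed.

(** Travelling backward gives the adjoint of a forward transfer matrix, so both
    directions obey the bounds [transfer_upper] and [transfer_lower]. After division
    by t the constants disappear, and in the upper bound r can be taken as close to
    rho as desired. *)
Lemma C_inftyE lam : 0 < lam ->
  C_infty (scale_damping lam a) = - (ln (spectral_radius (monodromy D lam)) / T).
Proof.
move=> lam0; set rho := spectral_radius _.
have rho0 : 0 < rho by exact/spectral_radius_gt0/monodromy_unit.
pose G t z := propagator (scale_damping lam a) t z.
have Gfwd t z : cosphere z -> 0 <= t -> exists x y, [/\ x <= y, y - x = t &
    mxnorm1 (G t z) = mxnorm1 (transfer D lam x y)].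
  move=> zS t0; rewrite /G (propagatorE a_damping D lam0 zS).
  have [->|->] := sg_cases zS.
    by exists z.1, (z.1 + t); split; rewrite ?mul1r ?lerDl// addrC addKr.
  exists (z.1 - t), z.1; split; first by rewrite gerBl.
    by rewrite opprB addrC subrK.
  by rewrite (mulN1r lam) (mulN1r t) -(transfer_adj D lam) mxnorm1_adj.
have G_gt0 t z : cosphere z -> 0 < mxnorm1 (G t z).
  move=> zS; rewrite /G (propagatorE a_damping D lam0 zS); apply: mxnorm1_gt0.
  apply/eqP => t0; have := transferK D (2 * z.2 * lam) z.1 (z.1 + 2 * z.2 * t).
  by rewrite t0 mul0mx => /esym/eqP; rewrite oner_eq0.
pose m : R := (n.+1 * n.+1)%:R.
have m0 : 0 < m by rewrite ltr0n.
have op_gt0 t z : cosphere z -> 0 < opnorm (G t z).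
  move=> zS; have := lt_le_trans (G_gt0 t z zS) (opnorm_ge _).
  by rewrite pmulr_rgt0.
pose S t := sup [set ln (opnorm (G t z)) | z in @cosphere R].
have z0S : cosphere ((0, 1 / 2) : R * R) by rewrite /cosphere /= ger0_norm// divr_ge0.
have upper r : rho < r -> exists2 C, 0 < C & forall t, 0 <= t ->
    ubound [set ln (opnorm (G t z)) | z in @cosphere R] (ln C + t / T * ln r).
  move=> /transfer_upper[C C0 bC]; exists C => // t t0 _ [z zS <-].
  have [x [y [xy yx GE]]] := Gfwd t z zS t0.
  rewrite -[t / T * ln r]expRK -lnM ?posrE ?expR_gt0//.
  rewrite ler_ln ?posrE ?mulr_gt0 ?expR_gt0 ?op_gt0//.
  by apply: le_trans (opnorm_le _) _; rewrite GE -yx bC.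
have [c c0 bc] := transfer_lower lam.
have lower t : 0 <= t -> ln (c / m) + t / T * ln rho <= S t.
  move=> t0; apply: (@le_trans _ _ (ln (opnorm (G t (0, 1 / 2))))).
    have [x [y [xy yx GE]]] := Gfwd t _ z0S t0.
    have cm0 : 0 < c / m by rewrite divr_gt0.
    rewrite -[t / T * ln rho]expRK -lnM ?posrE ?expR_gt0//.
    rewrite ler_ln ?posrE ?(mulr_gt0 cm0 (expR_gt0 _)) ?op_gt0//.
    rewrite mulrAC ler_pdivrMr// [leRHS]mulrC.
    by apply: le_trans (opnorm_ge _); rewrite GE -yx bc.
  apply: ub_le_sup; last by exists (0, 1 / 2).
  have [|C C0 bC] := upper (rho + 1); first by rewrite ltrDl.
  by exists (ln C + t / T * ln (rho + 1)); exact: bC.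
apply: cvg_lim => //; apply/cvgrPdist_le => e e0.
(* chosen so that (ln r - ln rho) / T = e / 2 *)
pose r := rho * expR (e * T / 2).
have rho_r : rho < r.
  by rewrite /r ltr_pMr// -expR0 ltr_expR divr_gt0// mulr_gt0.
have [C C0 bC] := upper r rho_r.
have lnr : ln r = ln rho + e * T / 2 by rewrite lnM ?posrE ?expR_gt0// expRK.
have e20 : 0 < e / 2 by rewrite divr_gt0.
have near1 : \forall t \near +oo_R, `|ln (c / m) / t| <= e.
  by have /cvgr0_norm_le/(_ _ e0) := cvgy_div (ln (c / m)).
have near2 : \forall t \near +oo_R, `|ln C / t| <= e / 2.
  by have /cvgr0_norm_le/(_ _ e20) := cvgy_div (ln C).
near=> t.
have t0 : 0 < t by near: t; exact: nbhs_pinfty_gt.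
have h1 : `|ln (c / m) / t| <= e by near: t; exact: near1.
have h2 : `|ln C / t| <= e / 2 by near: t; exact: near2.
have Sup : S t <= ln C + t / T * ln r.
  apply: ge_sup; last exact/bC/ltW.
  by exists (ln (opnorm (G t (0, 1 / 2)))), (0, 1 / 2).
have Slo := lower t (ltW t0).
rewrite -/(S t) mulN1r mulNr -[t^-1 * _]mulrC.
have Sup' : S t / t <= ln C / t + ln rho / T + e / 2.
  rewrite ler_pdivrMr//; apply: le_trans Sup _; rewrite lnr.
  by rewrite le_eqVlt; apply/orP; left; apply/eqP; field; rewrite !gt_eqF.
have Slo' : ln (c / m) / t + ln rho / T <= S t / t.
  rewrite ler_pdivlMr//; apply: le_trans Slo.
  by rewrite le_eqVlt; apply/orP; left; apply/eqP; field; rewrite !gt_eqF.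
move: h1 h2; rewrite !ler_norml => /andP[h1 h1'] /andP[h2 h2'].
by apply/andP; split; lra.
Unshelve. all: by end_near. Qed.

Lemma monodromy_expsum i j : is_expsum (fun lam => monodromy D lam i j).
Proof.
rewrite /monodromy; move: i j; elim: (arcs D) => [|k IH] i j /=.
  exact: is_expsum_cst.
under eq_fun do rewrite mxE; apply: is_expsum_sum => l.
by apply: is_expsumM => //; exact: herm_exp_expsum.
Qed.

Lemma monodromy0 : monodromy D 0 = 1%:M.
Proof.
rewrite /monodromy; elim: (arcs D) => //= k ->.
by rewrite /arc_factor mul0r herm_exp0 mulmx1.
Qed.

Lemma angle_ge0 k x : (k < N)%N -> 0 <= angle D k x.
Proof.
move=> kN; rewrite subr_ge0; have := clamp_ge D k x.
have b0 : 0 <= brk D k by exact: brk_ge0 (ltnW kN).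
rewrite le_eqVlt => /predU1P[<-//|bc].
have dp y : brk D k <= y -> is_derive y 1 (prim D k) (wgt D k y).
  by move=> ky; apply: prim_derive; rewrite (lt_le_trans _ ky)// (lt_le_trans _ b0).
have [||y _ E] := MVT bc (f := prim D k) (df := wgt D k).
- by move=> y; rewrite in_itv /= => /andP[/ltW /dp].
- apply: continuous_in_subspaceT => y; rewrite inE /= in_itv /= => /andP[/dp d _].
  apply: differentiable_continuous; apply/derivable1_diffP.
  exact: (@ex_derive _ _ _ _ _ _ _ d).
by rewrite -subr_ge0 E mulr_ge0 ?wgt_ge0// subr_ge0 ltW.
Qed.

Lemma monodromy_radius_le1 lam : 0 <= lam -> spectral_radius (monodromy D lam) <= 1.
Proof.
move=> lam0; apply: spectral_radius_le1 => v; rewrite -/(sqnorm _) -/(sqnorm v).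
rewrite /monodromy.
suff H k : (k <= N)%N -> forall v, sqnorm (v *m fund0 D lam k (2 * pi)) <= sqnorm v.
  exact: H (leqnn N) v.
elim: k => [_|k IH kN] {}v /=; first by rewrite mulmx1.
rewrite mulmxA; apply: le_trans (IH (ltnW kN) _) _.
by apply: herm_exp_contraction; [exact: dir_psd|rewrite mulr_ge0// angle_ge0].
Qed.

Lemma C_infty_limits :
  (exists2 l : R, 0 <= l &
     C_infty (scale_damping lambda a) / lambda @[lambda --> +oo_R] --> l) /\
  (exists l : R,
     C_infty (scale_damping lambda a) / lambda @[lambda --> (0 : R)^'+] --> l).
Proof.
have CE x : 0 < x -> C_infty (scale_damping x a) / x =
    - T^-1 * (ln (spectral_radius (monodromy D x)) / x).
  by move=> x0; rewrite C_inftyE// !mulNr; congr (- _); rewrite mulrCA mulrA.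
have transfer_limit (F : set_system R) (FF : Filter F) l : (\forall x \near F, 0 < x) ->
    ln (spectral_radius (monodromy D x)) / x @[x --> F] --> l ->
    C_infty (scale_damping x a) / x @[x --> F] --> - T^-1 * l.
  move=> F0 h; have : - T^-1 * (ln (spectral_radius (monodromy D x)) / x)
      @[x --> F] --> - T^-1 * l.
    by apply: cvgM => //; exact: cvg_cst.
  apply: cvg_trans; apply: near_eq_cvg; apply: filterS F0 => x x0.
  by rewrite CE.
have uP x := monodromy_unit D x.
split.
- have [l hl] := ln_spectral_radius_cvgy monodromy_expsum uP.
  have F0 : \forall x \near +oo_R, 0 < x by exact: nbhs_pinfty_gt.
  exists (- T^-1 * l); last exact: transfer_limit.
  rewrite mulNr -mulrN mulr_ge0 ?invr_ge0 ?(ltW T0)// oppr_ge0.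
  apply: (cvgr_to_le hl); apply: filterS F0 => x x0.
  rewrite ler_pdivrMr// mul0r; apply: ln_le0.
  exact/monodromy_radius_le1/ltW.
- have [l hl] := ln_spectral_radius_cvg0 monodromy_expsum uP monodromy0.
  exists (- T^-1 * l); apply: transfer_limit => //; exact: nbhs_right_gt.
Qed.

End DampingRate.

(** * The two types of damping *)

Section DirectedDampings.
Variables (R : realType) (n : nat).
Implicit Type a : R -> 'M[R[i]]_n.
Let T : R := 2 * pi.
Let T0 : 0 < T. Proof. by rewrite mulr_gt0// pi_gt0. Qed.

Lemma piecewise_constant_directed a : damping a -> piecewise_constant a ->
  inhabited (directed_damping a).
Proof.
move=> [_ a_psd] [s [s_path /eqP s_last] a_cst].
have /choice[A AP] : forall k, exists A, (k < size s)%N -> forall x,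
    nth 0 (0 :: s) k < x < nth 0 s k -> a x = A.
  move=> k; have [ks|_] := ltnP k (size s); last by exists 0.
  by have [A hA] := a_cst k ks; exists A => _.
have brk_s k : (k < size s)%N -> nth 0 (0 :: s) k < nth 0 s k.
  by move=> ks; have /(pathP 0) := s_path; apply.
constructor; apply: (@DirectedDamping R n a (size s) (fun k => nth 0 (0 :: s) k) A
  (fun _ _ => 1) (fun _ x => x)) => //.
- by rewrite -s_last -nth_last; case: (s).
- move=> k ks; pose x := (nth 0 (0 :: s) k + nth 0 s k) / 2.
  have hx : nth 0 (0 :: s) k < x < nth 0 s k.
    by have := brk_s k ks; rewrite /x => h; apply/andP; split; lra.
  by rewrite -(AP k ks x hx).
- by move=> k x; exact: cst_continuous.
- by move=> k x ks hx; rewrite scale1r; exact: AP.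
Qed.

(** Any lower end below 0 would do; it has to be below 0 for the primitive to be
    differentiable on both sides at 0. *)
Lemma continuous_primitive (f : R -> R) : continuous f ->
  exists F : R -> R, forall x : R, -1 < x -> is_derive x 1 F (f x).
Proof.
move=> cf; exists (fun x => \int[lebesgue_measure]_(t in [set` `[-1, x]]) f t)%R => x x1.
have fi : lebesgue_measure.-integrable [set` Interval (BLeft (-1)) (BRight (x + 1))]
    (EFin \o f).
  apply: continuous_compact_integrable; first exact: segment_compact.
  exact: continuous_subspaceT.
have xx1 : x < x + 1 by rewrite ltrDl.
have [] := continuous_FTC1 xx1 fi _ (cf x); first by rewrite lte_fin.
by rewrite derive1E => d1 d2; apply: DeriveDef.
Qed.

(** The translates of the bump have disjoint supports: on the k-th of the m arcs of
    length 2 pi / m only the term whose index is - k modulo m survives. *)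
Lemma bump_damping_directed a : bump_damping a -> inhabited (directed_damping a).
Proof.
move=> [[|m'] [A [psi [m1 A_psd [psi_per psi_smooth psi_ge0 _ psi_supp] aE]]]] //.
set m := m'.+1 in A A_psd psi_supp aE *.
have mR0 : 0 < m%:R :> R by rewrite ltr0n.
have psi_continuous x : {for x, continuous psi}.
  apply: differentiable_continuous; apply/derivable1_diffP.
  exact: (psi_smooth 0%N x).
pose ix k : 'I_m := inord ((m - k) %% m).
pose w k x := psi (x + 2 * pi * (ix k)%:R / m%:R).
have w_continuous k : continuous (w k).
  move=> x; apply: (@continuous_comp _ _ _ (fun x => x + 2 * pi * (ix k)%:R / m%:R) psi).
    by apply: continuousD => //; exact: cst_continuous.
  exact: psi_continuous.
have /choice[W WP] := fun k => continuous_primitive (w_continuous k).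
constructor; apply: (@DirectedDamping R n a m (fun k => T * k%:R / m%:R)
  (fun k => A (ix k)) w W) => //.
- by rewrite mulr0 mul0r.
- by rewrite mulfK// gt_eqF.
- by move=> k km; rewrite ltr_pM2r ?invr_gt0// ltr_pM2l// ltr_nat.
- by move=> k x; exact: psi_ge0.
- move=> k x km /andP[kx xk]; rewrite aE (bigD1 (ix k))//= big1 ?addr0// => i ik.
  have [->|/eqP psi_neq0] := eqVneq (psi (x + 2 * pi * i%:R / m%:R)) 0.
    by rewrite scale0r.
  (* the shifted point lies in the (k + i)-th arc, and in the support modulo 2 pi,
     i.e. in the 0-th arc modulo m *)
  exfalso; move/negP: ik; apply; apply/eqP/val_inj.
  have : closure [set x | psi x != 0] (x + 2 * pi * i%:R / m%:R).
    by apply: subset_closure; apply/eqP.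
  move=> /psi_supp [l /=].
  rewrite -/T => /andP[lo hi].
  have scale (u v : R) : T * u / m%:R < T * v / m%:R -> u < v.
    by rewrite ltr_pM2r ?invr_gt0// ltr_pM2l.
  have lR : l%:~R * T = T * (l%:~R * m%:R) / m%:R by field; rewrite gt_eqF.
  have intE : ((k + i)%N%:Z + l * m%:Z)%:~R = k%:R + i%:R + l%:~R * m%:R :> R.
    by rewrite intrD intrM -!pmulrn natrD.
  have up : ((k + i)%N%:Z + l * m%:Z < 1).
    rewrite -(ltr_int R) intE; apply: scale.
    rewrite mulr1; apply: le_lt_trans hi; rewrite lR !mulrDr !mulrDl.
    rewrite lerD2r lerD2r; exact: ltW.
  have dn : (-1 < (k + i)%N%:Z + l * m%:Z).
    rewrite -(ltr_int R) intE; apply: scale.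
    have : 0 < T * (k.+1%:R + i%:R + l%:~R * m%:R) / m%:R.
      apply: lt_trans lo _; rewrite lR !mulrDr !mulrDl.
      by rewrite ltrD2r ltrD2r.
    rewrite -natr1 !mulrDr !mulrDl mulrN1 mulr1 !mulNr; lra.
  have : ((k + i)%N%:Z = - l * m%:Z) by lia.
  move=> E; rewrite inordK ?ltn_mod//.
  have im : (i < m)%N by [].
  have : (m %| k + i)%N.
    by have : (m%:Z %| (k + i)%N%:Z)%Z by rewrite E dvdz_mull.
  move=> /dvdnP[q qE].
  have [k0|k0] := posnP k.
    rewrite k0 subn0 modnn; have : (q * m < m)%N by rewrite -qE k0.
    by rewrite -{2}[m]mul1n ltn_mul2r /= => q1; lia.
  have : (q * m < 2 * m)%N by rewrite -qE; lia.
  rewrite ltn_mul2r /= => q2; rewrite modn_small; last by lia.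
  have : q = 1%N by nia.
  lia.
Qed.

End DirectedDampings.

Theorem mainTheorem4 (R : realType) (n : nat) (n_ge1 : (1 <= n)%N)
    (a : R -> 'M[R[i]]_n) (a_damping : damping a)
    (a_type : piecewise_constant a \/ bump_damping a) :
  (exists2 l : R, 0 <= l &
     C_infty (scale_damping lambda a) / lambda @[lambda --> +oo_R] --> l) /\
  (exists l : R,
     C_infty (scale_damping lambda a) / lambda @[lambda --> (0 : R)^'+] --> l).
Proof.
have [D] : inhabited (directed_damping a).
  by case: a_type; [exact: piecewise_constant_directed|exact: bump_damping_directed].
by case: n n_ge1 a a_damping a_type D => // n _ a a_damping _; exact: C_infty_limits.
Qed.
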